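(* For every finite group $G$ there is a smooth affine curve $C$ over $\Bbbk$ such that $\operatorname{Aut}(C)\simeq G$, where $\operatorname{Aut}(C)$ is the group of automorphisms of the variety $C$.
   Context: The base field $\Bbbk$ is algebraically closed of characteristic zero. Curves are varieties over $\Bbbk$ and are understood to be irreducible. *)

(* Defs.v *)
From HB Require Import structures.
From mathcomp Require Import all_boot all_order all_fingroup all_algebra.
From mathcomp Require Import boolp classical_sets.
From mathcomp Require Import mpoly.

Set Implicit Arguments.
Unset Strict Implicit.
Unset Printing Implicit Defensive.

Import GRing.Theory.
Local Open Scope ring_scope.
Local Open Scope classical_set_scope.

Section AffineVarieties.
Variable k : closedFieldType.

(* Affine n-space is ['rV[k]_n]; a polynomial [f] takes the value
   [f.@[x ord0]] at the point [x]. *)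

Definition vanishes_on n (X : set 'rV[k]_n) (f : {mpoly k[n]}) : Prop :=
  forall x, X x -> f.@[x ord0] = 0.

Definition zariski_closed n (X : set 'rV[k]_n) : Prop :=
  exists S : set {mpoly k[n]},
    X = [set x | forall f, S f -> f.@[x ord0] = 0].

Definition irreducible_closed n (X : set 'rV[k]_n) : Prop :=
  [/\ zariski_closed X, X !=set0 &
      forall Y Z : set 'rV[k]_n, zariski_closed Y -> zariski_closed Z ->
        X = Y `|` Z -> X = Y \/ X = Z].

Definition has_irreducible_chain n (X : set 'rV[k]_n) (d : nat) : Prop :=
  exists Z : nat -> set 'rV[k]_n,
    (forall i, (i <= d)%N -> irreducible_closed (Z i) /\ Z i `<=` X) /\
    (forall i, (i < d)%N -> Z i `<` Z i.+1).

Definition has_dimension n (X : set 'rV[k]_n) (d : nat) : Prop :=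
  has_irreducible_chain X d /\ ~ has_irreducible_chain X d.+1.

Definition tangent_space n (X : set 'rV[k]_n) (p : 'rV[k]_n) :
    set 'rV[k]_n :=
  [set v | forall f, vanishes_on X f ->
     \sum_(i < n) (f^`M(i)).@[p ord0] * v ord0 i = 0].

(* Only meant for irreducible [X], where the local dimension of [X] is the
   same at all points. *)
Definition smooth n (X : set 'rV[k]_n) : Prop :=
  exists d, has_dimension X d /\
    forall p, X p -> exists V : {vspace 'rV[k]_n},
      [set` V] = tangent_space X p /\ \dim V = d.

Definition affine_curve n (X : set 'rV[k]_n) : Prop :=
  irreducible_closed X /\ has_dimension X 1.

Definition regular_map n m (X : set 'rV[k]_n) (Y : set 'rV[k]_m)
    (f : X -> Y) : Prop :=
  exists P : 'I_m -> {mpoly k[n]},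
    forall x : X, val (f x) = \row_i (P i).@[val x ord0].

Definition is_automorphism n (X : set 'rV[k]_n) (f : X -> X) : Prop :=
  regular_map f /\
  exists g : X -> X, [/\ regular_map g, cancel f g & cancel g f].

Lemma regular_id n (X : set 'rV[k]_n) : regular_map (@id X).
Proof.
exists (fun i => 'X_i) => x; apply/rowP => i.
by rewrite mxE mevalXU.
Qed.

Lemma regular_comp n m l (X : set 'rV[k]_n) (Y : set 'rV[k]_m)
    (Z : set 'rV[k]_l) (f : Y -> Z) (g : X -> Y) :
  regular_map f -> regular_map g -> regular_map (f \o g).
Proof.
move=> [P fP] [Q gQ].
exists (fun i => P i \mPo [tuple Q j | j < m]) => x; apply/rowP => i.
rewrite /= fP gQ !mxE comp_mpoly_meval.
by apply: meval_eq => j; rewrite !mxE !tnth_mktuple.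
Qed.

Record var_aut n (X : set 'rV[k]_n) := VarAut {
  var_aut_fun :> X -> X;
  var_autP : `[< is_automorphism var_aut_fun >] }.

HB.instance Definition _ n (X : set 'rV[k]_n) := [isSub for @var_aut_fun n X].
HB.instance Definition _ n (X : set 'rV[k]_n) := [Choice of var_aut X by <:].

Section AutGroup.
Variables (n : nat) (X : set 'rV[k]_n).
Implicit Types f g h : var_aut X.

Lemma var_aut_ext f g : f =1 g -> f = g.
Proof. by move=> fg; apply/val_inj/funext. Qed.

Lemma var_aut_one_subproof : `[< is_automorphism (@id X) >].
Proof.
apply/asboolP; split; first exact: regular_id.
by exists id; split=> //; exact: regular_id.
Qed.

Definition var_aut_one : var_aut X := VarAut var_aut_one_subproof.

Lemma var_aut_mul_subproof f g : `[< is_automorphism (f \o g) >].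
Proof.
have /asboolP[rf [f' [rf' fK f'K]]] := var_autP f.
have /asboolP[rg [g' [rg' gK g'K]]] := var_autP g.
apply/asboolP; split; first exact: regular_comp.
exists (g' \o f').
by split; [exact: regular_comp | exact: can_comp | exact: can_comp].
Qed.

Definition var_aut_mul f g : var_aut X := VarAut (var_aut_mul_subproof f g).

Lemma var_aut_inv_subproof f :
  exists g : var_aut X, cancel f g /\ cancel g f.
Proof.
have /asboolP[rf [g [rg fK gK]]] := var_autP f.
have ag : `[< is_automorphism g >] by apply/asboolP; split=> //; exists f.
by exists (VarAut ag).
Qed.

Definition var_aut_inv f : var_aut X := projT1 (cid (var_aut_inv_subproof f)).

Lemma var_aut_funK f : cancel f (var_aut_inv f).
Proof. by rewrite /var_aut_inv; case: cid => g []. Qed.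

Lemma var_aut_invK f : cancel (var_aut_inv f) f.
Proof. by rewrite /var_aut_inv; case: cid => g []. Qed.

Lemma var_aut_mulA : associative var_aut_mul.
Proof. by move=> f g h; apply: var_aut_ext. Qed.

Lemma var_aut_mul1 : left_id var_aut_one var_aut_mul.
Proof. by move=> f; apply: var_aut_ext. Qed.

Lemma var_aut_mulr1 : right_id var_aut_one var_aut_mul.
Proof. by move=> f; apply: var_aut_ext. Qed.

Lemma var_aut_mulV : left_inverse var_aut_one var_aut_inv var_aut_mul.
Proof. by move=> f; apply: var_aut_ext; exact: var_aut_funK. Qed.

Lemma var_aut_mulrV : right_inverse var_aut_one var_aut_inv var_aut_mul.
Proof. by move=> f; apply: var_aut_ext; exact: var_aut_invK. Qed.

HB.instance Definition _ := isGroup.Build (var_aut X)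
  var_aut_mulA var_aut_mul1 var_aut_mulr1 var_aut_mulV var_aut_mulrV.

End AutGroup.

End AffineVarieties.

Definition group_isomorphic (G H : groupType) : Prop :=
  exists f : G -> H, {morph f : x y / (x * y)%g} /\ bijective f.

(* Main.v *)
(* Let p = n.+1 be a prime exceeding #|G|. The curve X of ordered roots of
   T^p - T - s carries an action of S_p, hence of G by Cayley's theorem. It is
   irreducible: the stabiliser of a component is a transitive subgroup of S_p
   containing a transposition, because the discriminant has simple zeros, and p
   is prime.
   Remove from X the ramified fibres, the zeros of a G-invariant function w
   meeting a fibre in a single G-orbit, a large number of further fibres, and one
   last fibre s = c. An automorphism phi of what remains sends a removed point to
   a removed point or to infinity. Let d bound [k(X) : k(s)]. Then s o phi takes
   every value at most d times, and for two such phi (possibly with different c)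
   the functions s o phi satisfy a relation of bidegree at most (d, d), so they
   are equal as soon as they agree at more than 2d^2 points. If for every c there
   were a phi with s o phi <> s, then by the pigeonhole principle infinitely many
   c would share the same function s o phi, and comparing its values over the
   fibres s = c would give s o phi = s. Hence some c only allows phi in S_p, and w
   then forces phi into G. *)

Require Import Defs.
From mathcomp Require Import all_boot all_fingroup all_algebra polyXY.
From mathcomp Require Import boolp classical_sets mpoly filter ring zify.

Set Implicit Arguments.
Unset Strict Implicit.
Unset Printing Implicit Defensive.

Import GRing.Theory.
Local Open Scope ring_scope.

(** An automorphism of an affine curve need not respect the map s, and neither completion nor genus
    is used: everything is read off by counting points. The extra removed fibres supply test points.
    At a test point s o phi has a pole (at most d times), equals c (at most d times), or equals one
    of finitely many numbers that do not depend on c; the pigeonhole sorts the parameters c by this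
    last, finite record. Hence 2d + 2d^2 + 1 test points leave more than 2d^2 at which two
    automorphisms with the same record agree. The linear term of the trinomial makes the branching
    simple: the derivative p T^(p-1) - 1 has distinct roots c, and the critical values -(p-1)c/p are
    distinct too. Rational functions are functions on points, compared off the zeros of a polynomial
    that is not identically zero on X; irreducibility is what makes finitely many such comparisons
    compatible. *)

Section ClosedFieldPoly.
Variable k : closedFieldType.

Lemma poly_ext (q r : {poly k}) : (forall z, q.[z] = r.[z]) -> q = r.
Proof.
move=> qr; apply/eqP; rewrite -subr_eq0; apply: contraT => /closed_nonrootP[z].
by rewrite /root hornerD hornerN qr subrr eqxx.
Qed.

Lemma poly_nonroot (q : {poly k}) : q != 0 -> exists z, q.[z] != 0.
Proof. by move=> /closed_nonrootP[z]; exists z. Qed.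

Lemma horner_mmap n (E : 'I_n -> {poly k}) (t : {mpoly k[n]}) z :
  (mmap (@polyC k) E t).[z] = t.@[fun i => (E i).[z]].
Proof.
rewrite mevalE /mmap horner_sum; apply: eq_bigr => m _.
rewrite hornerM hornerC; congr (_ * _); rewrite /mmap1 horner_prod.
by apply: eq_bigr => i _; rewrite horner_exp.
Qed.

Lemma meval_msym n (s : 'S_n) (Q : {mpoly k[n]}) (v : 'I_n -> k) :
  (msym s Q).@[v] = Q.@[fun i => v (s i)].
Proof.
rewrite (mevalE _ Q) /msym /mmap raddf_sum; apply: eq_bigr => m _ /=.
rewrite mevalM mevalC; congr (_ * _); rewrite /mmap1 rmorph_prod.
by apply: eq_bigr => i _; rewrite rmorphXn /= mevalXU.
Qed.

Definition mhorner n (q : {poly k}) (S : {mpoly k[n]}) : {mpoly k[n]} :=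
  \sum_(i < size q) q`_i *: S ^+ i.

Lemma meval_horner n (q : {poly k}) (S : {mpoly k[n]}) (v : 'I_n -> k) :
  (mhorner q S).@[v] = q.[S.@[v]].
Proof.
rewrite raddf_sum horner_coef; apply: eq_bigr => i _ /=.
by rewrite mevalZ rmorphXn.
Qed.

End ClosedFieldPoly.

(** * The curve of ordered roots of a trinomial *)

Section RootCurve.
Variables (k : closedFieldType) (n : nat).
Hypothesis n_gt0 : (0 < n)%N.

Local Notation pt := {ffun 'I_n.+1 -> k}.
Implicit Types (x y : pt) (s : 'S_n.+1) (Q R : {mpoly k[n.+1]}).

Definition trin (z : k) : k := z ^+ n.+1 - z.
Definition trin_poly : {poly k} := 'X^(n.+1) - 'X.

Lemma horner_trin_poly z : trin_poly.[z] = trin z.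
Proof. by rewrite !hornerE. Qed.

Definition base x : k := trin (x ord0).
Definition base_mp : {mpoly k[n.+1]} := 'X_ord0 ^+ n.+1 - 'X_ord0.

Lemma meval_base_mp x : base_mp.@[x] = base x.
Proof. by rewrite mevalB rmorphXn /= mevalXU. Qed.

(* Since s = base x is trin of the first coordinate, the condition says that the
   coordinates of x are the roots of T^(n+1) - T - s. *)
Definition onX x : Prop := forall z, \prod_i (z - x i) = trin z - base x.

Lemma onX_polyP x : onX x <-> \prod_i ('X - (x i)%:P) = trin_poly - (base x)%:P.
Proof.
split=> [Xx | Xx z].
  apply: poly_ext => z; rewrite horner_prod !hornerE -Xx.
  by apply: eq_bigr => i _; rewrite !hornerE.
move/(congr1 (horner^~ z)): Xx; rewrite horner_prod !hornerE => <-.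
by apply: eq_bigr => i _; rewrite !hornerE.
Qed.

Lemma onX_trin x i : onX x -> trin (x i) = base x.
Proof.
move=> /(_ (x i)); rewrite (bigD1 i) //= subrr mul0r => /esym/eqP.
by rewrite subr_eq0 => /eqP.
Qed.

Definition act s x : pt := [ffun i => x (s i)].

Lemma act1 x : act 1 x = x.
Proof. by apply/ffunP => i; rewrite ffunE perm1. Qed.

Lemma actM s t x : act (s * t) x = act s (act t x).
Proof. by apply/ffunP => i; rewrite !ffunE permM. Qed.

Lemma actK s : cancel (act s) (act s^-1).
Proof. by move=> x; rewrite -actM mulVg act1. Qed.

Lemma actKV s : cancel (act s^-1) (act s).
Proof. by move=> x; rewrite -actM mulgV act1. Qed.

Lemma base_act s x : onX x -> base (act s x) = base x.
Proof. by move=> Xx; rewrite /base ffunE onX_trin. Qed.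

Lemma onX_act s x : onX x -> onX (act s x).
Proof.
move=> Xx z; rewrite base_act // -Xx [RHS](reindex_inj (@perm_inj _ s)).
by apply: eq_bigr => i _; rewrite ffunE.
Qed.

Lemma meval_msym_act s Q x : (msym s Q).@[x] = Q.@[act s x].
Proof. by rewrite meval_msym; apply: meval_eq => i; rewrite ffunE. Qed.

Lemma fiber_ex t : exists2 x, onX x & base x = t.
Proof.
have szf : size (trin_poly - t%:P) = n.+2.
  rewrite /trin_poly -addrA size_polyDl size_polyXn // -opprD size_polyN.
  by rewrite size_polyDl size_polyX // ltnS (leq_trans (size_polyC_leq1 _)).
have lf : lead_coef (trin_poly - t%:P) = 1.
  by rewrite lead_coefE szf !coefE eqxx gtn_eqF // !subr0.
have [r] := closed_field_poly_normal (trin_poly - t%:P).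
rewrite lf scale1r => Er.
have sr : size r = n.+1.
  by apply/eqP; rewrite -eqSS -szf Er size_prod_XsubC.
pose x : pt := [ffun i => r`_(val i)].
have Ex : \prod_i ('X - (x i)%:P) = trin_poly - t%:P.
  rewrite Er [RHS](big_nth 0) sr big_mkord.
  by apply: eq_bigr => i _; rewrite ffunE.
have xt : base x = t.
  move/(congr1 (horner^~ (x ord0))): Ex; rewrite horner_prod (bigD1 ord0) //=.
  rewrite !hornerE subrr mul0r => /esym/eqP; rewrite subr_eq0 => /eqP <-.
  by [].
by exists x; rewrite // onX_polyP xt.
Qed.

Lemma fiber_act x y : onX x -> onX y -> base x = base y ->
  exists s, y = act s x.
Proof.
move=> /onX_polyP Xx /onX_polyP Xy exy.
have Ey : \prod_(c <- [tuple y i | i < n.+1]) ('X - c%:P) =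
          \prod_(c <- [tuple x i | i < n.+1]) ('X - c%:P).
  rewrite !big_tuple.
  under eq_bigr do rewrite tnth_mktuple; under [RHS]eq_bigr do rewrite tnth_mktuple.
  by rewrite Xx Xy exy.
have /tuple_permP[s /val_inj Es] := prod_XsubC_eq Ey.
exists s; apply/ffunP => i; have := congr1 (fun t : _.-tuple _ => tnth t i) Es.
by rewrite !tnth_mktuple ffunE.
Qed.

(** It suffices to treat the elementary symmetric polynomials, and on X these are, up to sign, the
    coefficients of T^(n+1) - T - s. *)
Lemma symmetric_onX Q : Q \is symmetric ->
  exists q : {poly k}, forall x, onX x -> Q.@[x] = q.[base x].
Proof.
move=> /sym_fundamental[t [<- _]].
(* Vieta's formulas; only the constant coefficient, the case [n.+1 - i.+1 == 0], involves s. *)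
pose E (i : 'I_n.+1) : {poly k} :=
  (-1) ^+ i.+1 *: ((trin_poly`_(n.+1 - i.+1))%:P - (n.+1 - i.+1 == 0)%N%:R *: 'X).
exists (mmap (@polyC k) E t) => x Xx.
rewrite comp_mpoly_meval horner_mmap; apply: meval_eq => i.
rewrite tnth_mktuple.
have := @mroots_coeff _ _ [tuple x j | j < n.+1] (lift ord0 i).
rewrite big_tuple; under eq_bigr do rewrite tnth_mktuple.
move/onX_polyP: Xx => ->; rewrite lift0 coefB coefC.
move=> /(congr1 (fun u => (-1) ^+ i.+1 * u)); rewrite mulrA -exprD.
rewrite -[X in _ = X * _]signr_odd addnn odd_double mul1r.
rewrite (_ : _.@[_] = (mesym n.+1 k i.+1).@[x]); last first.
  by apply: meval_eq => j; rewrite tnth_mktuple.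
move=> <-; rewrite !hornerE; congr (_ * (_ - _)).
by case: eqP; rewrite ?mul1r ?mul0r.
Qed.

(** Descent to the line. The sum runs over permutations, not over the points of a fibre, so ramified
    fibres need no separate treatment; [norm_onX] is the multiplicative analogue. *)
Lemma trace_onX Q :
  exists q : {poly k}, forall x, onX x -> \sum_s Q.@[act s x] = q.[base x].
Proof.
have /symmetric_onX[q Eq] : \sum_s msym s Q \is symmetric.
  apply/issymP => t; rewrite raddf_sum [RHS](reindex_inj (mulIg t)) /=.
  by apply: eq_bigr => s _; rewrite msymMm.
exists q => x /Eq <-; rewrite raddf_sum; apply: eq_bigr => s _ /=.
by rewrite meval_msym_act.
Qed.

Lemma norm_onX Q :
  exists q : {poly k}, forall x, onX x -> \prod_s Q.@[act s x] = q.[base x].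
Proof.
have /symmetric_onX[q Eq] : \prod_s msym s Q \is symmetric.
  apply/issymP => t; rewrite rmorph_prod [RHS](reindex_inj (mulIg t)) /=.
  by apply: eq_bigr => s _; rewrite msymMm.
exists q => x /Eq <-; rewrite rmorph_prod; apply: eq_bigr => s _ /=.
by rewrite meval_msym_act.
Qed.

Lemma interpolation (r : seq pt) x : x \notin r ->
  exists Q, Q.@[x] = 1 /\ forall y, y \in r -> Q.@[y] = 0.
Proof.
elim: r => [|y r IHr]; first by exists 1; rewrite meval1.
rewrite inE negb_or => /andP[nxy /IHr[Q [Qx Qr]]].
have /existsP[i ni] : [exists i, x i != y i].
  by apply: contraR nxy => /existsPn e; apply/eqP/ffunP => i; apply/eqP/negPn/e.
exists ((x i - y i)^-1 *: ('X_i - (y i)%:MP) * Q); split=> [|z].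
  by rewrite mevalM Qx mulr1 mevalZ mevalB mevalXU mevalC mulVf // subr_eq0.
rewrite inE mevalM mevalZ mevalB mevalXU mevalC => /orP[/eqP->|/Qr->].
  by rewrite subrr mulr0 mul0r.
by rewrite mulr0.
Qed.

End RootCurve.

(** * Multiplicities of roots from derivatives *)

Section Multiplicity.
Variable k : closedFieldType.
Implicit Types (q : {poly k}) (c : k).

Lemma mup_eq1 q c : q.[c] = 0 -> q^`().[c] != 0 -> mup c q = 1%N.
Proof.
move=> /rootP/factor_theorem[r ->]; rewrite derivM derivXsubC !hornerE subrr.
rewrite mulr0 add0r => rc; rewrite mupMr // -[X in mup _ X]expr1 mup_XsubCX.
by rewrite eqxx.
Qed.

Lemma mup_eq2 q c : q.[c] = 0 -> q^`().[c] = 0 -> q^`()^`().[c] != 0 ->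
  mup c q = 2%N.
Proof.
move=> /rootP/factor_theorem[r ->].
rewrite !(derivM, derivXsubC, derivD, mulr1, mulr0, deriv0, derivC, hornerE).
rewrite subrr !mulr0 !add0r => rc.
rewrite /= addr0 -mulr2n -mulr_natl mulf_eq0 negb_or => /andP[_ r'c].
have r0 : r != 0 by apply: contraNneq r'c => ->; rewrite deriv0 horner0.
by rewrite mupM ?polyXsubC_eq0 // (mup_eq1 rc r'c) -[X in mup _ X]expr1 mup_XsubCX eqxx.
Qed.

End Multiplicity.

(** * Ramification *)

Section Discriminant.
Variables (k : closedFieldType) (n : nat).
Hypotheses (k0 : [pchar k] =i pred0) (n_gt0 : (0 < n)%N).

Local Notation pt := {ffun 'I_n.+1 -> k}.
Implicit Types (x y : pt) (s : 'S_n.+1) (Q R : {mpoly k[n.+1]}).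

Lemma natk_neq0 m : (0 < m)%N -> m%:R != 0 :> k.
Proof. by case: m => // m _; move/pcharf0P: k0 => ->. Qed.

Definition dtrin_poly : {poly k} := n.+1%:R *: 'X^n - 1.
Definition dtrin (z : k) : k := n.+1%:R * z ^+ n - 1.

Lemma horner_dtrin_poly z : dtrin_poly.[z] = dtrin z.
Proof. by rewrite !hornerE. Qed.

Lemma deriv_trin_poly : (trin_poly k n)^`() = dtrin_poly.
Proof. by rewrite /trin_poly derivB derivXn derivX /= -scaler_nat. Qed.

Lemma dtrin_prod x i : onX x -> \prod_(j | j != i) (x i - x j) = dtrin (x i).
Proof.
move=> /onX_polyP Xx; have := congr1 (fun q => (deriv q).[x i]) Xx.
rewrite /= derivB derivC subr0 deriv_trin_poly horner_dtrin_poly => <-.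
rewrite [in RHS](bigD1 i) //= derivM derivXsubC !hornerE subrr mul0r addr0.
by rewrite horner_prod; apply: eq_bigr => j _; rewrite !hornerE.
Qed.

Definition crit : seq k := projT1 (closed_field_poly_normal dtrin_poly).

Lemma dtrin_polyE : dtrin_poly = n.+1%:R *: \prod_(c <- crit) ('X - c%:P).
Proof.
rewrite /crit; case: closed_field_poly_normal => r /= Er.
rewrite {1}Er; congr (_ *: _).
rewrite lead_coefE /dtrin_poly size_polyDl size_scale ?natk_neq0 // ?size_polyXn.
  by rewrite !coefE eqxx mulr1 gtn_eqF // subr0.
by rewrite size_polyN size_poly1 ltnS.
Qed.

Lemma dtrinE z : dtrin z = n.+1%:R * \prod_(c <- crit) (z - c).
Proof.
rewrite -horner_dtrin_poly dtrin_polyE hornerZ horner_prod; congr (_ * _).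
by apply: eq_bigr => c _; rewrite !hornerE.
Qed.

Lemma mem_crit c : (c \in crit) = (dtrin c == 0).
Proof.
rewrite -horner_dtrin_poly dtrin_polyE -[_ == 0]/(root _ c) rootZ ?natk_neq0 //.
by rewrite root_prod_XsubC.
Qed.

Lemma dtrin_neq0 c : dtrin c = 0 -> c != 0.
Proof.
move=> ec; apply: contra_eq_neq ec => ->.
by rewrite /dtrin expr0n gtn_eqF // mulr0 sub0r oppr_eq0 oner_eq0.
Qed.

Lemma dtrin_poly_deriv_neq0 c : dtrin c = 0 -> dtrin_poly^`().[c] != 0.
Proof.
move=> /dtrin_neq0 c0; rewrite derivB derivZ derivXn derivC subr0.
rewrite !hornerE hornerMn hornerXn -(mulr_natl (c ^+ _)).
by rewrite !mulf_neq0 ?natk_neq0 // expf_neq0.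
Qed.

Lemma crit_uniq : uniq crit.
Proof.
apply: count_mem_uniq => c.
have /= := mup_eq1 (q := dtrin_poly) (c := c).
have n1 : n.+1%:R != 0 :> k by rewrite natk_neq0.
rewrite {3}dtrin_polyE -mul_polyC mupMr ?rootC // mu_prod_XsubC.
have [cr /(_ _ _)->//|/count_memPn//] := boolP (c \in crit).
  by rewrite horner_dtrin_poly; apply/eqP; rewrite -mem_crit.
by apply: dtrin_poly_deriv_neq0; apply/eqP; rewrite -mem_crit.
Qed.

(** At a critical point c^n = 1/(n+1), so the critical value is linear in c; this separates the
    critical values. *)
Lemma trin_crit c : c \in crit -> n.+1%:R * trin n c = - (n%:R * c).
Proof.
rewrite mem_crit /dtrin subr_eq0 => /eqP cn.
rewrite /trin mulrBr exprSr mulrA cn mul1r -[n.+1]addn1 natrD; ring.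
Qed.

Lemma trin_crit_inj : {in crit &, injective (trin n : k -> k)}.
Proof.
move=> c d /trin_crit fc /trin_crit fd e; move: fc; rewrite e fd => /oppr_inj.
by move/(mulfI (natk_neq0 n_gt0)).
Qed.

(** The discriminant up to sign, as the resultant with the derivative: the product of x_i - c over
    all i is (-1)^(n+1) (trin c - s), which explains the exponent [n.+2]. *)
Definition delta : {poly k} :=
  n.+1%:R ^+ n.+1 *: \prod_(c <- crit) ((-1) ^+ n.+2 *: ('X - (trin n c)%:P)).

Lemma deltaE x : onX x -> \prod_i dtrin (x i) = delta.[base x].
Proof.
move=> Xx; rewrite hornerZ horner_prod.
under eq_bigr do rewrite dtrinE.
rewrite big_split /= prodr_const card_ord exchange_big /=; congr (_ * _).
apply: eq_bigr => c _; rewrite !hornerE exprSr -mulrA mulN1r opprB -Xx.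
under eq_bigr do rewrite -opprB -mulN1r.
by rewrite big_split /= prodr_const card_ord.
Qed.

Lemma delta_neq0 : delta != 0.
Proof.
rewrite scaler_eq0 negb_or expf_neq0 ?natk_neq0 //=; rewrite prodf_seq_neq0.
apply/allP => c _ /=; by rewrite scaler_eq0 signr_eq0 polyXsubC_eq0.
Qed.

Lemma mup_delta c : c \in crit -> mup (trin n c) delta = 1%N.
Proof.
move=> cr; have K (a : k) : a != 0 -> ~~ root a%:P (trin n c) by rewrite rootC.
have -> : delta = (n.+1%:R ^+ n.+1 * ((-1) ^+ n.+2) ^+ size crit)%:P *
    \prod_(d <- [seq trin n c | c <- crit]) ('X - d%:P).
  rewrite /delta big_map polyCM -mul_polyC -mulrA; congr (_ * _).
  elim: crit => [|d r IHr]; first by rewrite !big_nil mul1r.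
  by rewrite !big_cons {}IHr /= [(_ ^+ n.+2) ^+ _.+1]exprS polyCM -mul_polyC; ring.
rewrite mupMr ?K ?mulf_neq0 ?expf_neq0 ?natk_neq0 ?oppr_eq0 ?oner_eq0 //.
rewrite mu_prod_XsubC count_uniq_mem ?map_f //.
by rewrite map_inj_in_uniq ?crit_uniq //; exact: trin_crit_inj.
Qed.

Lemma delta_inj x : onX x -> delta.[base x] != 0 -> injective x.
Proof.
move=> Xx; rewrite -deltaE // => /prodf_neq0 d i j xij; apply/eqP.
apply: contraNT (d i isT) => ij; rewrite -dtrin_prod // (bigD1 j) 1?eq_sym //=.
by rewrite xij subrr mul0r.
Qed.

Lemma delta_dtrin x i : onX x -> delta.[base x] != 0 -> dtrin (x i) != 0.
Proof. by move=> Xx; rewrite -deltaE // => /prodf_neq0; apply. Qed.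

(** The root c is exactly double because the second derivative does not vanish there; any other
    multiple root would be a second critical point with the same critical value. *)
Lemma crit_fiber c x : c \in crit -> onX x -> base x = trin n c ->
  exists i j, [/\ i != j, x i = x j &
    forall s, act s x = x -> s = 1%g \/ s = tperm i j].
Proof.
move=> cr Xx sx; have dc : dtrin c = 0 by apply/eqP; rewrite -mem_crit.
have mc : mup c (trin_poly k n - (trin n c)%:P) = 2%N.
  have d1 : (trin_poly k n - (trin n c)%:P)^`() = dtrin_poly.
    by rewrite derivB derivC subr0 deriv_trin_poly.
  apply: mup_eq2; last by rewrite d1; exact: dtrin_poly_deriv_neq0.
    by rewrite hornerD hornerN hornerC horner_trin_poly subrr.
  by rewrite d1 horner_dtrin_poly.
move: (Xx) => /onX_polyP; rewrite sx => Ex; move: mc; rewrite -Ex.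
rewrite -(big_map x xpredT (fun a => 'X - a%:P)) mu_prod_XsubC count_map.
move=> c2; have /eqP/cards2P[i [j [ij Eij]]] : #|[set a | x a == c]| = 2%N.
  by rewrite -c2 -size_filter cardE /enum_mem; congr size; apply: eq_filter => a; rewrite !inE.
have xi : x i = c by apply/eqP; have := set21 i j; rewrite -Eij inE.
have xj : x j = c by apply/eqP; have := set22 i j; rewrite -Eij inE.
exists i, j; split; rewrite ?xi //.
move=> s fs; have fs' a : x (s a) = x a by rewrite -[in RHS]fs ffunE.
have fix_s a : a != i -> a != j -> s a = a.
  move=> ai aj; have xa : x a != c.
    by move/setP/(_ a): Eij; rewrite !inE (negbTE ai) (negbTE aj) => ->.
  apply/eqP; apply: contraNT xa => sa; apply/eqP; apply: trin_crit_inj => //.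
    by rewrite mem_crit -dtrin_prod // (bigD1 (s a)) //= fs' subrr mul0r.
  by rewrite onX_trin.
have mem_ij a : x a = c -> a = i \/ a = j.
  by move=> xa; have := in_set2 a i j; rewrite -Eij inE xa eqxx => /esym/orP[]/eqP; auto.
have [si|si] := mem_ij (s i) (etrans (fs' i) xi).
  left; apply/permP => a; rewrite perm1.
  have [->//|ai] := eqVneq a i; have [->|/fix_s->//] := eqVneq a j.
  have [sj|//] := mem_ij (s j) (etrans (fs' j) xj).
  by move: ij; rewrite -(inj_eq (@perm_inj _ s)) si sj eqxx.
right; apply/permP => a; case: tpermP => [->//|->|/eqP ai /eqP aj]; last exact: fix_s.
have [//|sj] := mem_ij (s j) (etrans (fs' j) xj).
by move: ij; rewrite -(inj_eq (@perm_inj _ s)) si sj eqxx.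
Qed.

End Discriminant.

(** * Irreducibility *)

(* The classes of the relation "the transposition of i and j lies in H" are
   permuted by H, hence all have the same size, which divides the prime m. *)
Lemma prime_transitive_tperm m (H : {group 'S_m}) (a i j : 'I_m) : prime m ->
  (forall b, exists2 h, h \in H & h a = b) -> i != j -> tperm i j \in H ->
  forall s, s \in H.
Proof.
move=> m_pr trH ij Hij.
pose R b c := tperm b c \in H.
have RJ h b c : h \in H -> R (h b) (h c) = R b c.
  by move=> Hh; rewrite /R -tpermJ groupJr.
have Rrefl b : R b b by rewrite /R tperm1 group1.
have Rsym b c : R b c = R c b by rewrite /R tpermC.
have Rtr b c d : R b c -> R b d = R c d.
  move=> Rbc; have [<-|bd] := eqVneq b d; first by rewrite Rrefl Rsym.
  have [<-|cd] := eqVneq c d; first by rewrite Rrefl.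
  rewrite -(RJ (tperm b c)) // tpermL tpermD //.
have eqR : {in [set: 'I_m] & &, equivalence_rel R}.
  by move=> b c d _ _ _; split; [exact: Rrefl | exact: Rtr].
have partR := equivalence_partitionP eqR.
pose c0 := #|[set b | R a b]|.
have cls b : #|[set d | R b d]| = c0.
  have [h Hh <-] := trH b.
  rewrite -(card_preimset [set d | R (h a) d] (@perm_inj _ h)).
  by apply: eq_card => d; rewrite !inE RJ.
have uR : {in equivalence_partition R [set: 'I_m], forall A : {set 'I_m}, #|A| = c0}.
  move=> A /imsetP[b _ ->].
  by rewrite -(cls b); apply: eq_card => d; rewrite !inE.
have dv : (c0 %| m)%N.
  by have := card_uniform_partition uR partR; rewrite cardsT card_ord => ->; exact: dvdn_mull.
have c0gt1 : (1 < c0)%N.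
  rewrite -(cls i); apply/card_gt1P; exists i, j; split; rewrite ?inE //.
have c0m : c0 = m.
  by apply/eqP; move/primeP: m_pr => [_ /(_ _ dv)]; rewrite gtn_eqF.
have allR b c : R b c.
  have /eqP/setP/(_ c) : [set d | R b d] == [set: 'I_m].
    by rewrite eqEcard finset.subsetT cardsT card_ord cls c0m /=.
  by rewrite !inE.
move=> s; have [ts -> _] := prod_tpermP s.
by rewrite big_seq; apply: group_prod => t _; apply: allR.
Qed.

Section Irreducibility.
Variables (k : closedFieldType) (n : nat).
Hypotheses (k0 : [pchar k] =i pred0) (p_pr : prime n.+1).

Local Notation pt := {ffun 'I_n.+1 -> k}.
Implicit Types (x y : pt) (s h : 'S_n.+1) (Q R : {mpoly k[n.+1]}).

Let n_gt0 : (0 < n)%N. Proof. by move/prime_gt1: p_pr. Qed.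

(* Such an ultrafilter plays the role of the generic point of a component. *)
Lemma generic_ultrafilter : exists U : set_system pt, UltraFilter U /\
  forall q : {poly k}, q != 0 -> U (fun x => onX x /\ q.[base x] != 0).
Proof.
pose F : set_system pt := fun A => exists2 q : {poly k}, q != 0 &
  forall x, onX x -> q.[base x] != 0 -> A x.
have FF : ProperFilter F.
  split.
    move=> [q /poly_nonroot[t qt] /=]; have [x Xx xt] := fiber_ex n_gt0 t.
    by move=> /(_ x Xx); rewrite xt => /(_ qt).
  split.
  - by exists 1; rewrite ?oner_neq0.
  - move=> A B [q q0 qA] [r r0 rB]; exists (q * r); first by rewrite mulf_neq0.
    by move=> x Xx; rewrite hornerM mulf_eq0 negb_or => /andP[? ?]; split; [exact: qA | exact: rB].
  - by move=> A B AB [q q0 qA]; exists q => // x Xx /(qA x Xx)/AB.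
have [U [UU FU]] := ultraFilterLemma FF.
by exists U; split=> // q q0; apply: FU; exists q.
Qed.

(** * The generic component and its decomposition group *)

Section Ultra.
Variable U : set_system pt.
Hypotheses (UU : UltraFilter U)
  (UX : forall q : {poly k}, q != 0 -> U (fun x => onX x /\ q.[base x] != 0)).

Let FU : ProperFilter U. Proof. exact: ultra_proper. Qed.
Let FU' : Filter U. Proof. exact: filter_filter. Qed.

(** The ideal of a component of X: prime because U is an ultrafilter, and meeting the polynomials in
    s only in zero ([vanU_base]). *)
Definition vanU Q : Prop := U (fun x => Q.@[x] = 0).

Let UonX : U (fun x => onX x).
Proof. by apply: filterS (UX (oner_neq0 _)) => x []. Qed.

Lemma vanU_prime Q R : vanU (Q * R) -> vanU Q \/ vanU R.
Proof.
move=> QR; have [//|nQ] := in_ultra_setVsetC (fun x => Q.@[x] = 0) UU; first by left.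
right; apply: filterS (filterI QR nQ) => x [/= + /eqP Qx].
by rewrite mevalM => /eqP; rewrite mulf_eq0 (negbTE Qx) => /eqP.
Qed.

Lemma vanU1 : ~ vanU 1.
Proof. by move=> /filter_ex[x]; rewrite meval1 => /eqP; rewrite oner_eq0. Qed.

Lemma vanU_prod (I : finType) (P : pred I) (F : I -> {mpoly k[n.+1]}) :
  vanU (\prod_(i | P i) F i) -> exists2 i, P i & vanU (F i).
Proof.
elim/big_ind: _ => [/vanU1//| Q R IQ IR /vanU_prime[]// | i Pi vi]; by exists i.
Qed.

Lemma vanU_base (q : {poly k}) : U (fun x => q.[base x] = 0) -> q = 0.
Proof.
move=> Uq; apply/eqP; apply: contraT => /UX q0.
by have [x [-> []]] := filter_ex (filterI Uq q0); rewrite eqxx.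
Qed.

(** Lying over. Otherwise some element of the ideal is 1 at every point of the fibre over t; its
    norm is a polynomial in s that vanishes on the component, hence is zero, yet it takes the value
    1 at t. *)
Lemma vanU_fiber t : exists x, [/\ onX x, base x = t & forall Q, vanU Q -> Q.@[x] = 0].
Proof.
have [x Xx xt] := fiber_ex n_gt0 t.
apply: contrapT => nx.
have /fin_all_exists[Q EQ] : forall s, exists Q, vanU Q /\ Q.@[act s x] = 1.
  move=> s; apply: contrapT => nQ; apply: nx.
  exists (act s x); split; [exact: onX_act | by rewrite base_act |].
  move=> Q vQ; apply/eqP; apply: contraT => Qs; exfalso; apply: nQ.
  exists ((Q.@[act s x])^-1 *: Q); split; last by rewrite mevalZ mulVf.
  by apply: filterS vQ => y /= Qy; rewrite mevalZ Qy mulr0.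
have /fin_all_exists[I EI] : forall s, exists I : {mpoly k[n.+1]}, I.@[act s x] = 1 /\
    forall h, act h x != act s x -> I.@[act h x] = 0.
  move=> s.
  have /interpolation[I [I1 I0]] : act s x \notin
      [seq act h x | h <- enum {: 'S_n.+1} & act h x != act s x].
    by apply/mapP => -[h]; rewrite mem_filter => /andP[/eqP hs _] /esym.
  exists I; split=> // h hs; apply: I0; apply: map_f.
  by rewrite mem_filter hs mem_enum.
(* One permutation is chosen for each point of the orbit, so that a ramified point contributes only
   one term to [R]. *)
pose rp s : 'S_n.+1 := odflt s [pick h | act h x == act s x].
pose R := \sum_(s | rp s == s) I s * Q s.
have vR : vanU R.
  have /filter_forall : forall s, U (fun y => (Q s).@[y] = 0) by move=> s; case: (EQ s).
  apply: filterS => y /= Qy; rewrite raddf_sum big1 //= => s _.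
  by rewrite mevalM Qy mulr0.
have rpE s : act (rp s) x = act s x.
  by rewrite /rp; case: pickP => //= h /eqP.
have rpK s h : act s x = act h x -> rp s = rp h.
  move=> e; rewrite /rp (eq_pick (Q := fun g => act g x == act h x)); last by move=> g; rewrite e.
  by case: pickP => // /(_ h); rewrite eqxx.
have R1 s : R.@[act s x] = 1.
  rewrite raddf_sum (bigD1 (rp s)) /=; last by rewrite (rpK (rp s) s) ?rpE.
  rewrite big1 ?addr0 => [|h /andP[/eqP hh hs]]; rewrite mevalM.
    by rewrite -(rpE s) (EI _).1 (EQ _).2 mulr1.
  rewrite (EI h).2 ?mul0r //; apply: contra hs => /eqP/rpK ->.
  by rewrite hh.
have [q Eq] := norm_onX R.
have q0 : q = 0.
  apply: vanU_base; apply: filterS (filterI UonX vR) => y [Xy Ry].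
  by rewrite -Eq // (bigD1 1%g) //= act1 Ry mul0r.
have := Eq _ Xx; rewrite q0 horner0 big1 => [/eqP|s _]; last exact: R1.
by rewrite oner_eq0.
Qed.

(** Stabiliser of the ideal. One inclusion suffices, since a nonempty subset of a finite group
    closed under products is a subgroup. *)
Definition decomp : {set 'S_n.+1} :=
  [set s | `[< forall Q, vanU Q -> vanU (msym s Q) >]].

Lemma decompP s : reflect (forall Q, vanU Q -> vanU (msym s Q)) (s \in decomp).
Proof. by rewrite inE; apply: asboolP. Qed.

Lemma decomp_group_set : group_set decomp.
Proof.
apply/group_setP; split; first by apply/decompP => Q; rewrite msym1m.
by move=> s t /decompP Hs /decompP Ht; apply/decompP => Q /Hs/Ht; rewrite msymMm.
Qed.

Canonical decomp_group := Group decomp_group_set.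

Lemma vanU_msym s Q : s \in decomp -> vanU (msym s Q) -> vanU Q.
Proof.
move=> Hs vQ; have /decompP/(_ _ vQ) : (s^-1)%g \in decomp by rewrite groupV.
by rewrite -msymMm mulgV msym1m.
Qed.

(** A function that singles out the component among its conjugates: a product of separators, one for
    each permutation outside the stabiliser, then a product over the stabiliser to make it
    invariant. Primality keeps it out of the ideal. *)
Lemma decomp_isolate : exists E, [/\ ~ vanU E,
  forall s, s \notin decomp -> vanU (msym s E) &
  forall h, h \in decomp -> msym h E = E].
Proof.
have /fin_all_exists[e Ee] : forall s, exists e, s \notin decomp ->
    ~ vanU e /\ vanU (msym s e).
  move=> s; have [sH|sH] := boolP (s \in decomp); first by exists 0.
  apply: contrapT => ne; case/negP: sH; rewrite -groupV.
  apply/decompP => Q vQ; apply: contrapT => nQ; apply: ne.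
  by exists (msym s^-1 Q) => _; split=> //; rewrite -msymMm mulVg msym1m.
pose e0 := \prod_(s | s \notin decomp) e s.
have ne0 : ~ vanU e0 by move=> /vanU_prod[s /Ee[]].
have ve0 s : s \notin decomp -> vanU (msym s e0).
  move=> sH; have [_ +] := Ee s sH; apply: filterS => x /= ex.
  by rewrite /e0 (bigD1 s) //= msymM mevalM ex mul0r.
exists (\prod_(h in decomp) msym h e0); split.
- by move=> /vanU_prod[h hH /(vanU_msym hH)].
- move=> s /ve0; apply: filterS => x /= ex.
  by rewrite (bigD1 1%g) //= msym1m msymM mevalM ex mul0r.
- move=> h hH; rewrite rmorph_prod [RHS](reindex_inj (mulIg h)) /=.
  apply: eq_big => [s|s _]; first by rewrite groupMr.
  by rewrite msymMm.
Qed.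

(** On the component the full trace of E a reduces to |decomp| E a, because E kills the other
    translates. Dividing by the trace of E, nonzero in characteristic zero, makes every invariant a
    rational function of s with one common denominator [q2]. *)
Lemma decomp_invariant : exists2 q2 : {poly k}, q2 != 0 &
  forall a, (forall h, h \in decomp -> msym h a = a) ->
  exists q1 : {poly k}, U (fun x => q2.[base x] * a.@[x] = q1.[base x]).
Proof.
have [E [nE vE hE]] := decomp_isolate.
have trE a : (forall h, h \in decomp -> msym h a = a) ->
    U (fun x => \sum_s (E * a).@[act s x] = #|decomp|%:R * E.@[x] * a.@[x]).
  move=> ha; have /filter_forall : forall s,
      U (fun x => s \notin decomp -> (msym s E).@[x] = 0).
    move=> s; have [sH|/vE] := boolP (s \in decomp).
      by apply: filterS UonX => x.
    by apply: filterS.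
  apply: filterS => x /= Ex.
  rewrite (bigID (mem decomp)) /= [X in _ + X]big1 ?addr0 => [|s /Ex]; last first.
    by rewrite mevalM -!meval_msym_act => ->; rewrite mul0r.
  rewrite -mulrA mulr_natl -sumr_const; apply: eq_bigr => s sH.
  by rewrite -meval_msym_act msymM mevalM hE // ha.
have [q2 Eq2] := trace_onX E.
have Uq2 : U (fun x => q2.[base x] = #|decomp|%:R * E.@[x]).
  have /trE : forall h, h \in decomp -> msym h (1 : {mpoly k[n.+1]}) = 1.
    by move=> h _; rewrite msym1.
  move=> /(filterI UonX); apply: filterS => x [Xx].
  by rewrite mulr1 meval1 mulr1 Eq2.
exists q2.
  apply/eqP => q20; apply: nE; apply: filterS Uq2 => x /= /esym/eqP.
  rewrite q20 horner0 mulf_eq0 (negbTE (natk_neq0 k0 _)) ?cardG_gt0 //.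
  by move=> /eqP.
move=> a /trE Ua; have [q1 Eq1] := trace_onX (E * a); exists q1.
apply: filterS (filterI UonX (filterI Ua Uq2)) => x [Xx [+ ->]] /=.
by rewrite Eq1.
Qed.

(** In effect T^(n+1) - T - s is irreducible over k(s). A smaller orbit O would give a factor of
    degree |O| with coefficients rational in s; then some nonzero relation of degree below n+1 would
    hold at all n+1 distinct roots of an unramified fibre. *)
Lemma decomp_trans b : exists2 h, h \in decomp & h ord0 = b.
Proof.
pose O := [set (h : 'S_n.+1) ord0 | h in decomp].
suff /setP/(_ b) : O = [set: 'I_n.+1]%SET.
  by rewrite finset.in_setT => /imsetP[h hH ->]; exists h.
apply/eqP; rewrite eqEcard finset.subsetT cardsT card_ord leqNgt /=.
apply/negP => ltO.
have [q2 q20 inv] := decomp_invariant.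
pose g : {poly {mpoly k[n.+1]}} := \prod_(i in O) ('X - ('X_i)%:P).
have gh h j : h \in decomp -> msym h g`_j = g`_j.
  move=> hH; rewrite -coef_map /= rmorph_prod /=.
  apply: (congr1 (fun u : {poly {mpoly k[n.+1]}} => u`_j)).
  rewrite /g [RHS](reindex_inj (@perm_inj _ h)) /=; apply: eq_big => [i | i _].
    apply/imsetP/imsetP => -[t tH].
      by move=> ->; exists (t * h)%g; rewrite ?groupM // permM.
    move=> e; exists (t * h^-1)%g; rewrite ?groupM ?groupV //.
    by rewrite permM -e permK.
  rewrite rmorphB /= map_polyX map_polyC /= /msym mmapX mmap1U //.
have sg : size g = #|O|.+1.
  by rewrite /g -big_enum size_prod_XsubC -cardE.
have gm : lead_coef g = 1.
  by apply/monicP; rewrite /g -big_enum monic_prod_XsubC.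
have /fin_all_exists[q1 Eq1] : forall j : 'I_(#|O|.+1), exists q1 : {poly k},
    U (fun x => q2.[base x] * (g`_j).@[x] = q1.[base x]).
  by move=> j; apply: inv => h hH; exact: gh.
(* Writing s as [trin] of the first coordinate turns the relation into a polynomial in that single
   coordinate. *)
pose Xi := \sum_(j < #|O|.+1) (q1 j \Po trin_poly k n) * 'X^j.
have Xiz z : Xi.[z] = \sum_(j < #|O|.+1) (q1 j).[trin n z] * z ^+ j.
  rewrite horner_sum; apply: eq_bigr => j _.
  by rewrite hornerM horner_comp horner_trin_poly hornerXn.
have UXi : U (fun x => Xi.[x ord0] = 0).
  have /filter_forall := Eq1; apply: filterS => x /= Ex.
  rewrite Xiz; under eq_bigr => j _ do rewrite -[trin _ _]/(base x) -Ex -mulrA.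
  rewrite -mulr_sumr (_ : \sum_(_ < _) _ = (map_poly (meval x) g).[x ord0]).
    have -> : map_poly (meval x) g = \prod_(i in O) ('X - (x i)%:P).
      rewrite rmorph_prod; apply: eq_bigr => i _.
      by rewrite rmorphB /= map_polyX map_polyC /= mevalXU.
    have O0 : ord0 \in O by apply/imsetP; exists 1%g; rewrite ?group1 ?perm1.
    by rewrite horner_prod (bigD1 ord0) //= hornerXsubC subrr mul0r mulr0.
  rewrite horner_coef size_map_poly_id0; last first.
    by rewrite gm meval1 oner_neq0.
  by rewrite sg; apply: eq_bigr => j _; rewrite coef_map.
(* The norm of Xi(x_0) is a polynomial in s vanishing on the component, hence zero; if Xi were
   nonzero, a fibre avoiding the values of [trin] at its roots would contradict this. *)
have Xi0 : Xi = 0.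
  apply/eqP; apply: contraT => Xi0.
  have [r Er] := closed_field_poly_normal Xi.
  pose S := \prod_(c <- r) ('X - (trin n c)%:P).
  have [t St] : exists t, S.[t] != 0.
    apply: poly_nonroot; rewrite prodf_seq_neq0.
    by apply/allP => c _ /=; rewrite polyXsubC_eq0.
  have [x Xx xt] := fiber_ex n_gt0 t.
  have [q Eq] := norm_onX (mhorner Xi 'X_(ord0 : 'I_n.+1)).
  have q0 : q = 0.
    apply: vanU_base; apply: filterS (filterI UonX UXi) => y [Xy Ry].
    by rewrite -Eq // (bigD1 1%g) //= act1 meval_horner mevalXU Ry mul0r.
  have /eqP := Eq _ Xx; rewrite q0 horner0 prodf_seq_eq0 => /hasP[s _ /= /eqP].
  rewrite meval_horner mevalXU ffunE => /eqP; rewrite -[_ == 0]/(root _ _) Er rootZ ?lead_coef_eq0 //.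
  rewrite root_prod_XsubC => /(map_f (trin n)); rewrite onX_trin // xt => tr.
  case/negP: St; rewrite /S -(big_map (trin n) xpredT (fun c => 'X - c%:P)).
  by rewrite -[_ == 0]/(root _ _) root_prod_XsubC.
have q1d (j : 'I_(#|O|.+1)) : q1 j = 0.
  suff /eqP : q1 j * delta k n = 0.
    by rewrite mulf_eq0 (negbTE (delta_neq0 n k0)) orbF => /eqP.
  apply: poly_ext => t; rewrite horner0 hornerM; apply/eqP; rewrite mulf_eq0.
  apply: contraT; rewrite negb_or => /andP[qt dt].
  have [x Xx xt] := fiber_ex n_gt0 t.
  pose T := \poly_(i < #|O|.+1) (q1 (inord i)).[t].
  have T0 : T != 0.
    apply: contraNneq qt => T0; have := congr1 (fun u : {poly k} => u`_j) T0.
    by rewrite coef_poly ltn_ord inord_val coef0 => ->.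
  have rT : all (root T) [seq x i | i <- enum 'I_n.+1].
    apply/allP => _ /mapP[i _ ->]; rewrite /root horner_poly.
    have := Xiz (x i); rewrite Xi0 horner0 => /esym/eqP.
    by under eq_bigr => i' _ do rewrite onX_trin // xt -[i' in q1 i']inord_val.
  have := max_poly_roots T0 rT.
  rewrite map_inj_uniq ?enum_uniq; last by apply: (delta_inj k0 n_gt0 Xx); rewrite xt.
  rewrite size_map size_enum_ord => /(_ isT) ltT.
  by have := leq_trans ltT (size_poly _ _); rewrite ltnS leqNgt ltO.
have := Eq1 ord_max; rewrite q1d (_ : g`_ _ = 1); last first.
  by rewrite -gm lead_coefE sg.
move=> Uq2; move/eqP: q20; apply; apply: vanU_base; apply: filterS Uq2 => x /=.
by rewrite meval1 mulr1 horner0.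
Qed.

(* If no transposition stabilises the generic component through a simple
   branch point x, then b below is nonzero at x, the Vandermonde determinant d
   times b is a rational function of s, while its square delta * b ^ 2 vanishes
   to odd order. *)
Lemma decomp_tperm : exists i j, i != j /\ tperm i j \in decomp.
Proof.
have [c cr] : exists c, c \in crit k n.
  have := dtrinE k0 n_gt0 0; case: (crit k n) => [|c r]; last by exists c; rewrite mem_head.
  rewrite big_nil mulr1 /dtrin expr0n gtn_eqF // mulr0 sub0r => /eqP.
  by rewrite eq_sym -subr_eq0 opprK -[X in _ + X]/(1%:R) -natrD (negbTE (natk_neq0 k0 _)).
have [x [Xx sx vx]] := vanU_fiber (trin n c).
have [i [j [ij xij fixx]]] := crit_fiber k0 n_gt0 cr Xx sx.
exists i, j; split=> //; apply: contraT => tH.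
have fix1 h : h \in decomp -> act h x = x -> h = 1%g.
  by move=> hH /fixx[]// E; rewrite E (negbTE tH) in hH.
have /interpolation[a [ax a0]] : x \notin [seq act h x | h <- enum decomp & h != 1%g].
  apply/mapP => -[h]; rewrite mem_filter mem_enum => /andP[h1 hH] /esym/(fix1 h hH)/eqP.
  by rewrite (negbTE h1).
(* The signed sum changes by the sign character, as the Vandermonde determinant does, so d b and b^2
   are invariant. Only the identity term survives at x, since no other element of the group fixes
   x. *)
pose b := \sum_(h in decomp) (-1) ^+ h *: msym h a.
have bx : b.@[x] = 1.
  rewrite raddf_sum (bigD1 1%g) ?group1 //=.
  rewrite mevalZ meval_msym_act act1 odd_perm1 mul1r ax.
  rewrite big1 ?addr0 // => h /andP[hH h1]; rewrite mevalZ meval_msym_act a0 ?mulr0 //.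
  by apply: map_f; rewrite mem_filter h1 mem_enum.
have hb h : h \in decomp -> msym h b = (-1) ^+ h *: b.
  move=> hH; rewrite raddf_sum scaler_sumr [RHS](reindex_inj (mulIg h)) /=.
  apply: eq_big => [s|s _]; first by rewrite groupMr.
  by rewrite msymZ msymMm scalerA -signr_addb odd_permM addbCA addbb addbF.
pose d : {mpoly k[n.+1]} := \det (Vandermonde n.+1 (\row_j 'X_j)).
have hd h : msym h d = (-1) ^+ h *: d.
  rewrite /d -det_map_mx (_ : map_mx _ _ = col_perm h (Vandermonde n.+1 (\row_j 'X_j))).
    rewrite col_permE det_mulmx det_perm odd_permV mulrC -mul_mpolyC.
    by rewrite rmorphXn /= rmorphN1.
  by apply/matrixP => i1 i2; rewrite !mxE rmorphXn /= /msym mmapX mmap1U.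
have dE y : d.@[y] = \prod_(i < n.+1) \prod_(j < n.+1 | (i < j)%N) (y j - y i).
  rewrite /d det_Vandermonde rmorph_prod; apply: eq_bigr => i1 _ /=.
  rewrite rmorph_prod; apply: eq_bigr => i2 _ /=.
  by rewrite !mxE mevalB !mevalXU.
pose e : k := \prod_(i < n.+1) \prod_(j < n.+1 | (i < j)%N) -1.
have e0 : e != 0.
  by do 2![apply/prodf_neq0 => ? _]; rewrite oppr_eq0 oner_eq0.
have d2 y : onX y -> e * d.@[y] ^+ 2 = (delta k n).[base y].
  move=> Xy; rewrite -(deltaE k0 n_gt0 Xy).
  under eq_bigr => i1 _ do rewrite -dtrin_prod // (bigID (fun i2 : 'I__ => i1 < i2)%N) /=.
  rewrite big_split /= expr2 mulrA; congr (_ * _).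
    rewrite /e dE -big_split /=; apply: eq_bigr => i1 _; rewrite -big_split /=.
    apply: eq_big => [i2|i2 _]; last by rewrite mulN1r opprB.
    by rewrite andb_idl // => lt12; rewrite -val_eqE /= neq_ltn lt12 orbT.
  rewrite dE (exchange_big_dep xpredT) //=; apply: eq_bigr => i1 _.
  by apply: eq_bigl => i2; rewrite -leqNgt ltn_neqAle -val_eqE.
have sgn2 (s : bool) (Q R : {mpoly k[n.+1]}) : ((-1) ^+ s *: Q) * ((-1) ^+ s *: R) = Q * R.
  by rewrite -scalerAl -scalerAr scalerA -signr_addb addbb scale1r.
have [q2 q20 inv] := decomp_invariant.
have [u Eu] : exists u : {poly k}, U (fun y => q2.[base y] * (d * b).@[y] = u.[base y]).
  by apply: inv => h hH; rewrite msymM hd hb // sgn2.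
have [r Er] : exists r : {poly k}, U (fun y => q2.[base y] * (b * b).@[y] = r.[base y]).
  by apply: inv => h hH; rewrite msymM hb // sgn2.
have Eur : e *: u ^+ 2 = q2 * r * delta k n.
  apply/eqP; rewrite -subr_eq0; apply/eqP/vanU_base.
  apply: filterS (filterI UonX (filterI Eu Er)) => y [Xy [uy ry]] /=.
  rewrite hornerD hornerN hornerZ horner_exp 2!hornerM -d2 // -uy -ry !mevalM; ring.
set t := trin n c in sx *.
have r0 : r != 0.
  apply/eqP => r0; suff : vanU b by move=> /vx /eqP; rewrite bx oner_eq0.
  suff /vanU_prime[] : vanU (b * b) by [].
  apply: filterS (filterI (UX q20) Er) => y [[_ qy] /eqP]; rewrite r0 horner0.
  by rewrite mulf_eq0 (negbTE qy) => /eqP.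
have d0 := delta_neq0 n k0.
have u0 : u != 0.
  apply: contraNneq (mulf_neq0 (mulf_neq0 q20 r0) d0) => u0.
  by rewrite -Eur u0 expr0n scaler0.
have tx (v w : {poly k}) :
    U (fun y => v.[base y] * (b * b).@[y] = w.[base y]) -> v.[t] = w.[t].
  move=> Uvw; have /vx : vanU (mhorner v (base_mp k n) * (b * b) - mhorner w (base_mp k n)).
    apply: filterS Uvw => y /= Ey.
    by rewrite mevalB mevalM !meval_horner meval_base_mp Ey subrr.
  rewrite mevalB !mevalM bx !mulr1 !meval_horner meval_base_mp sx => /eqP.
  by rewrite subr_eq0 => /eqP.
(* On the component r/q2 is b^2, which is 1 at x, so it has neither zero nor pole at t. This leaves
   the simple zero of the discriminant unpaired in [Eur]. *)
have mur : mup t q2 = mup t r.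
  have [m1 [q /=]] := multiplicity_XsubC q2 t; rewrite q20 /= => qt Eq.
  have [m2 [r' /=]] := multiplicity_XsubC r t; rewrite r0 /= => rt Er'.
  rewrite /root in qt rt.
  have Xm m : ('X - t%:P) ^+ m != 0 :> {poly k} by rewrite expf_neq0 // polyXsubC_eq0.
  rewrite Eq Er' !mupMr ?/root // !mup_XsubCX eqxx.
  have [lt|lt|//] := ltngtP m1 m2; exfalso.
    have /tx/eqP : U (fun y => q.[base y] * (b * b).@[y] =
        (r' * ('X - t%:P) ^+ (m2 - m1)).[base y]).
      apply: filterS (filterI (UX (Xm m1)) Er) => y [[_ yt]].
      rewrite Eq Er' !hornerM -{1}(subnK (ltnW lt)) exprD hornerM.
      by move: yt => /mulIf inj eqv; apply: inj; rewrite mulrAC eqv mulrA.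
    by rewrite hornerM horner_exp hornerXsubC subrr expr0n subn_eq0 leqNgt lt mulr0 (negbTE qt).
  have /tx/esym/eqP : U (fun y => (q * ('X - t%:P) ^+ (m1 - m2)).[base y] * (b * b).@[y] =
      r'.[base y]).
    apply: filterS (filterI (UX (Xm m2)) Er) => y [[_ yt]].
    rewrite Eq Er' !hornerM -{1}(subnK (ltnW lt)) exprD hornerM.
    by move: yt => /mulIf inj eqv; apply: inj; rewrite -eqv mulrAC !mulrA.
  by rewrite hornerM horner_exp hornerXsubC subrr expr0n subn_eq0 leqNgt lt mulr0 (negbTE rt).
have := congr1 (mup t) Eur.
rewrite -mul_polyC mupMr ?rootC // !mupM ?mulf_neq0 // mup_delta // mur addn1.
by rewrite addnn => /(congr1 odd); rewrite /= !odd_double addnn odd_double.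
Qed.

(** Once every permutation stabilises the ideal, the trace of Q a vanishes for all a. Taking a to be
    1 at x and 0 on the rest of its orbit leaves Q(x) times the order of the stabiliser of x. *)
Lemma vanU_onX Q : vanU Q -> forall x, onX x -> Q.@[x] = 0.
Proof.
have [i [j [ij Hij]]] := decomp_tperm.
have allH s : s \in decomp.
  exact: (prime_transitive_tperm (H := [group of decomp]) p_pr decomp_trans ij Hij).
move=> vQ x Xx.
have tr0 a : \sum_s (Q * a).@[act s x] = 0.
  have [q Eq] := trace_onX (Q * a); rewrite Eq // (_ : q = 0) ?horner0 //.
  apply: vanU_base.
  have /filter_forall : forall s, U (fun y => (msym s Q).@[y] = 0).
    by move=> s; have /decompP := allH s; apply.
  move=> /(filterI UonX); apply: filterS => y [Xy Qy]; rewrite -Eq // big1 // => s _.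
  by rewrite mevalM -meval_msym_act Qy mul0r.
have /interpolation[a [ax a0]] :
    x \notin [seq act s x | s <- enum {: 'S_n.+1} & act s x != x].
  by apply/mapP => -[s]; rewrite mem_filter => /andP[/eqP hs _] /esym.
have := tr0 a; rewrite (bigID (fun s => act s x == x)) /= [X in _ + X]big1 => [|s sx].
  under eq_bigr => s /eqP sx do rewrite mevalM sx ax mulr1.
  rewrite addr0 sumr_const -mulr_natl => /eqP; rewrite mulf_eq0 (negbTE (natk_neq0 k0 _)) //.
    by move/eqP.
  by apply/card_gt0P; exists 1%g; exact: (introT eqP (act1 x)).
by rewrite mevalM a0 ?mulr0 //; apply: map_f; rewrite mem_filter sx mem_enum.
Qed.

End Ultra.

Lemma onX_domain Q R : (forall x, onX x -> Q.@[x] * R.@[x] = 0) ->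
  (forall x, onX x -> Q.@[x] = 0) \/ (forall x, onX x -> R.@[x] = 0).
Proof.
move=> QR; have [U [UU UX]] := generic_ultrafilter.
have FU : Filter U by have := ultra_proper (F := U) => ?; exact: filter_filter.
have /(vanU_prime UU)[vQ|vR] : vanU U (Q * R).
- by apply: filterS (UX 1 (oner_neq0 _)) => x [Xx _]; rewrite mevalM QR.
- by left; exact: (vanU_onX UU UX vQ).
- by right; exact: (vanU_onX UU UX vR).
Qed.

End Irreducibility.

(** Gaussian elimination without division: the pivot row r clears the first column by
    cross-multiplication. *)
Lemma linear_relation (R : idomainType) d (v : 'I_d.+1 -> 'I_d -> R) :
  exists c : 'I_d.+1 -> R, (exists i, c i != 0) /\
    forall j, \sum_i c i * v i j = 0.
Proof.
elim: d v => [|d IHd] v.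
  by exists (fun=> 1); split=> [|[]//]; exists ord0; rewrite oner_neq0.
have [/existsP[r vr]|/existsPn v0] := boolP [exists r, v r ord0 != 0].
  have [c [[i ci] Ec]] := IHd (fun i j =>
    v r ord0 * v (lift r i) (lift ord0 j) - v (lift r i) ord0 * v r (lift ord0 j)).
  exists (fun i => if unlift r i is Some i' then v r ord0 * c i'
                   else - \sum_i' c i' * v (lift r i') ord0).
  split=> [|j]; first by exists (lift r i); rewrite /= liftK mulf_neq0.
  rewrite (bigD1_ord r) //= unlift_none; under [X in _ + X]eq_bigr do rewrite liftK.
  have [j'|] := unliftP ord0 j => ->; last first.
    rewrite mulNr mulr_suml addrC -sumrB big1 // => i' _; ring.
  rewrite mulNr mulr_suml addrC -sumrB -[RHS](Ec j'); apply: eq_bigr => i' _; ring.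
have [c [[i ci] Ec]] := IHd (fun i j => v (lift ord0 i) (lift ord0 j)).
exists (fun i => if unlift ord0 i is Some i' then c i' else 0).
split=> [|j]; first by exists (lift ord0 i); rewrite /= liftK.
rewrite (bigD1_ord ord0) //= unlift_none mul0r add0r; under eq_bigr do rewrite liftK.
have [j'|] := unliftP ord0 j => -> //.
by rewrite big1 // => i' _; rewrite (eqP (negPn (v0 _))) mulr0.
Qed.

Lemma card_fibers (T : eqType) m (t : 'I_m -> T) (r : seq T) d (A : {set 'I_m}) :
  (forall i, i \in A -> t i \in r) ->
  (forall c, (#|[set i in A | t i == c]| <= d)%N) -> (#|A| <= size r * d)%N.
Proof.
elim: r A => [|c r IHr] A tA dA.
  by rewrite leqn0 cards_eq0; apply/eqP/setP => i; rewrite inE; apply/negP => /tA.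
rewrite -(cardsID [set i | t i == c] A) mulSn leq_add //.
  by apply: leq_trans (dA c); apply/subset_leq_card/fintype.subsetP => i; rewrite !inE.
apply: IHr => [i|c']; first by rewrite !inE => /andP[ic /tA]; rewrite inE (negbTE ic).
by apply: leq_trans (dA c'); apply/subset_leq_card/fintype.subsetP => i; rewrite !inE => /andP[/andP[_ ->] ->].
Qed.

(** * Polynomial relations of small degree *)

Section SmallRelation.
Variable k : closedFieldType.
Implicit Types (u v : {poly {poly k}}) (c : {poly k}).

Lemma horner2_coef u (y z : k) : u.[y, z] = \sum_(i < size u) (u`_i).[z] * y ^+ i.
Proof.
rewrite [u.[_]]horner_coef horner_sum; apply: eq_bigr => i _.
by rewrite hornerM -rmorphXn hornerC.
Qed.

Lemma horner_diag u (z : k) : u.['X].[z] = u.[z, z].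
Proof.
rewrite horner2_coef [u.['X]]horner_coef horner_sum; apply: eq_bigr => i _.
by rewrite hornerM hornerXn.
Qed.

Lemma polyC_dvd u (z : k) : map_poly (horner_eval z) u = 0 ->
  exists v, u = ('X - z%:P)%:P * v.
Proof.
move=> uz; exists (\poly_(i < size u) (u`_i %/ ('X - z%:P))); apply/polyP => i.
rewrite coefCM coef_poly; case: ltnP => [_|/(nth_default 0)->]; last by rewrite mulr0.
have := congr1 (fun w : {poly k} => w`_i) uz; rewrite coef_map coef0 /= => ui.
by rewrite mulrC divpK // dvdp_XsubCl /root -[_.[_]]/(horner_eval z _) ui.
Qed.

Lemma nonroots (r : {poly k}) m : r != 0 ->
  exists b : 'I_m -> k, injective b /\ forall i, r.[b i] != 0.
Proof.
move=> r0; suff [s [us sr sm]] : exists s : seq k, [/\ uniq s, all (fun z => r.[z] != 0) s & size s = m].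
  exists (fun i => s`_i); split=> [i j /eqP|i].
    by rewrite nth_uniq ?sm // => /eqP/val_inj.
  by apply: (allP sr); rewrite mem_nth ?sm.
elim: m => [|m [s [us sr sm]]]; first by exists [::].
have [c] : exists z, (r * \prod_(a <- s) ('X - a%:P)).[z] != 0.
  by apply: poly_nonroot; rewrite mulf_neq0 // monic_neq0 // monic_prod_XsubC.
rewrite hornerM mulf_eq0 negb_or => /andP[rc]; rewrite -[_ == 0]/(root _ c).
by rewrite root_prod_XsubC => cs; exists (c :: s); rewrite /= cs us rc sr sm.
Qed.

(** If each class lay in the zeros of a nonzero polynomial, the product of these polynomials would
    vanish everywhere. Infinitude of a class is phrased as escaping every nonzero r, the form in
    which it is used. *)
Lemma pigeonhole (T : finType) (d : k -> T) :
  exists tau, forall r : {poly k}, r != 0 -> exists z, d z = tau /\ r.[z] != 0.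
Proof.
apply: contrapT => nt.
have /fin_all_exists2[r r0 rd] : forall tau, exists2 r : {poly k}, r != 0 &
    forall z, d z = tau -> r.[z] = 0.
  move=> tau; apply: contrapT => nr; apply: nt; exists tau => r r0.
  apply: contrapT => nc; apply: nr; exists r => // z dz; apply/eqP; apply: contraT => rz.
  by case: nc; exists z.
have [z] : exists z, (\prod_tau r tau).[z] != 0.
  by apply: poly_nonroot; apply/prodf_neq0.
by rewrite horner_prod (bigD1 (d z)) //= rd // mul0r eqxx.
Qed.

Lemma min_measure (T : Type) (P : T -> Prop) (mu : T -> nat) : (exists x, P x) ->
  exists2 x, P x & forall y, P y -> (mu x <= mu y)%N.
Proof.
move=> [x Px]; have [m] := ubnP (mu x); elim: m x Px => // m IHm x Px xm.
have [[y Py yx]|ny] := pselect (exists2 y, P y & (mu y < mu x)%N).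
  by apply: (IHm y Py); apply: leq_trans yx _.
by exists x => // y Py; rewrite leqNgt; apply/negP => yx; apply: ny; exists y.
Qed.

(** Gauss's lemma. At a root z of c, the specialisation of w u is zero while that of u is not, so
    the linear factor divides w and can be cancelled. *)
Lemma primitive_dvd u v c : c != 0 -> (forall z, map_poly (horner_eval z) u != 0) ->
  (exists w, c%:P * v = w * u) -> exists w, v = w * u.
Proof.
move=> + pu; have [m] := ubnP (size c); elim: m c => // m IHm c cm c0 [w Ew].
have [c1|c1] := eqVneq (size c) 1%N.
  have /size_poly1P[a a0 Ec] : size c == 1%N by rewrite c1.
  exists ((a^-1)%:P%:P * w); rewrite -mulrA -Ew mulrA -polyCM Ec -polyCM mulVf //.
  by rewrite mul1r.
have /closed_rootP[z cz] := c1.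
have /factor_theorem[c' Ec] := cz.
have /polyC_dvd[w' Ew'] : map_poly (horner_eval z) w = 0.
  apply/eqP; have /eqP := congr1 (map_poly (horner_eval z)) Ew.
  rewrite !rmorphM /= map_polyC /= [horner_eval z c](rootP cz) mul0r eq_sym mulf_eq0.
  by rewrite (negbTE (pu z)) orbF.
have X0 : 'X - z%:P != 0 :> {poly k} by rewrite polyXsubC_eq0.
have c'0 : c' != 0 by apply: contraNneq c0 => c'0; rewrite Ec c'0 mul0r.
apply: (IHm c') => //.
  by move: cm; rewrite Ec size_Mmonic ?monicXsubC // size_XsubC addn2 /=.
exists w'; have X0' : ('X - z%:P)%:P != 0 :> {poly {poly k}} by rewrite polyC_eq0.
apply: (mulfI X0'); rewrite mulrA -polyCM [_ * c']mulrC -Ec Ew Ew'; ring.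
Qed.

(* The prime ideal P of relations between two functions contains an element
   of minimal degree in one variable; cleared of its content, it divides every
   other element of P, so its degree in the other variable is small as well. *)
Lemma small_relation (P : {poly {poly k}} -> Prop) d v w :
  (forall u u', P u -> P u' -> P (u + u')) -> (forall u u', P u -> P (u' * u)) ->
  (forall u u', P (u * u') -> P u \/ P u') ->
  (forall c, P c%:P -> c = 0) -> ~ P ('X - 'X%:P) ->
  v != 0 -> P v -> (size v <= d.+1)%N -> w != 0 -> P w -> (sizeY w <= d.+1)%N ->
  exists u, [/\ P u, u.['X] != 0 & (size u.['X] <= d.*2.+1)%N].
Proof.
move=> PD PM Pprime Pc PXY v0 Pv sv w0 Pw sw.
have [u1 [u10 Pu1] min1] := min_measure (P := fun u => u != 0 /\ P u)
  (fun u => size u) (ex_intro _ v (conj v0 Pv)).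
have [u [u0 Pu su] min2] := min_measure
  (P := fun u => [/\ u != 0, P u & size u = size u1]) (fun u => size (lead_coef u))
  (ex_intro _ u1 (And3 u10 Pu1 erefl)).
have minu y : y != 0 -> P y -> (size u <= size y)%N by move=> y0 Py; rewrite su min1.
have pu z : map_poly (horner_eval z) u != 0.
  apply/eqP => /polyC_dvd[u' Eu'].
  have u'0 : u' != 0 by apply: contraNneq u0 => u'0; rewrite Eu' u'0 mulr0.
  have Pu' : P u'.
    move: Pu; rewrite Eu' => /Pprime[/Pc/eqP|//].
    by rewrite polyXsubC_eq0.
  have z0 : 'X - z%:P != 0 :> {poly k} by rewrite polyXsubC_eq0.
  have su' : size u' = size u1 by rewrite -su Eu' size_Cmul.
  have := min2 u' (And3 u'0 Pu' su'); rewrite Eu' lead_coefM lead_coefC.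
  by rewrite mulrC size_Mmonic ?monicXsubC ?lead_coef_eq0 // size_XsubC addn2 /= ltnn.
have [c [c0 [w' Ew']]] : exists c, c != 0 /\ exists w', c%:P * w = w' * u.
  exists (lead_coef u ^+ Pdiv.IdomainDefs.scalp w u).
  split; first by rewrite expf_neq0 // lead_coef_eq0.
  exists (Pdiv.IdomainDefs.divp w u).
  have := Pdiv.Idomain.divp_eq w u; rewrite -mul_polyC => E.
  rewrite E -[RHS]addr0; congr (_ + _); apply/eqP; apply: contraT => r0.
  have := Pdiv.Idomain.ltn_modp w u; rewrite u0 ltnNge minu //.
  have -> : Pdiv.IdomainDefs.modp w u = (lead_coef u ^+ Pdiv.IdomainDefs.scalp w u)%:P * w +
      (- Pdiv.IdomainDefs.divp w u) * u by rewrite E; ring.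
  by apply: PD; apply: PM.
have [w1 Ew1] := primitive_dvd c0 pu (ex_intro _ w' Ew').
have w10 : w1 != 0 by apply: contraNneq w0 => w10; rewrite Ew1 w10 mul0r.
have sYu : (sizeY u <= d.+1)%N.
  apply: leq_trans sw; rewrite !sizeYE Ew1 rmorphM /= size_mul ?swapXY_eq0 //.
  by rewrite -[X in (X + _).-1]prednK ?size_poly_gt0 ?swapXY_eq0 // addSn /= leq_addl.
exists u; split=> //.
  (* If u vanished on the diagonal, primality would put the quotient by the diagonal equation in P,
     with smaller degree. *)
  apply/negP => /factor_theorem[u' Eu'].
  have u'0 : u' != 0 by apply: contraNneq u0 => u'0; rewrite Eu' u'0 mul0r.
  have Pu' : P u' by move: Pu; rewrite Eu' => /Pprime[].
  have := minu u' u'0 Pu'.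
  by rewrite {1}Eu' size_Mmonic ?monicXsubC // size_XsubC addn2 /= ltnn.
apply: leq_trans (max_size_evalX u) _.
have : (size u <= d.+1)%N by rewrite su; apply: leq_trans sv; apply: min1.
by case: (size u) => [|m] /=; lia.
Qed.

End SmallRelation.

(** * Rational functions and their values *)

Section Germs.
Variables (k : closedFieldType) (n : nat).
Hypotheses (k0 : [pchar k] =i pred0) (p_pr : prime n.+1).

Local Notation pt := {ffun 'I_n.+1 -> k}.
Local Notation mp := {mpoly k[n.+1]}.
Implicit Types (x y q : pt) (Q R D a b e : mp) (F G : pt -> k).

Let n_gt0 : (0 < n)%N. Proof. by move/prime_gt1: p_pr. Qed.

Definition nzX D : Prop := exists2 x, onX x & D.@[x] != 0.

Lemma nzXM D R : nzX D -> nzX R -> nzX (D * R).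
Proof.
move=> [x Xx Dx] [y Xy Ry]; apply: contrapT => nz.
have [z Xz||] := onX_domain k0 p_pr (Q := D) (R := R).
- by apply/eqP; apply: contraT => DR; case: nz; exists z; rewrite ?mevalM.
- by move=> /(_ x Xx)/eqP; rewrite (negbTE Dx).
- by move=> /(_ y Xy)/eqP; rewrite (negbTE Ry).
Qed.

Lemma nzX1 : nzX 1.
Proof. by have [x Xx _] := fiber_ex n_gt0 (0 : k); exists x; rewrite // meval1 oner_neq0. Qed.

Lemma nzX_base (r : {poly k}) : r != 0 -> nzX (mhorner r (base_mp k n)).
Proof.
move=> /poly_nonroot[t rt]; have [x Xx xt] := fiber_ex n_gt0 t.
by exists x; rewrite // meval_horner meval_base_mp xt.
Qed.

Lemma nzX_prod (I : finType) (P : pred I) (E : I -> mp) :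
  (forall i, P i -> nzX (E i)) -> nzX (\prod_(i | P i) E i).
Proof. by move=> nzE; elim/big_ind: _ => //; [exact: nzX1 | exact: nzXM]. Qed.

Definition gen (P : pt -> Prop) : Prop :=
  exists2 D, nzX D & forall x, onX x -> D.@[x] != 0 -> P x.

Lemma genS (P P' : pt -> Prop) :
  (forall x, onX x -> P x -> P' x) -> gen P -> gen P'.
Proof. by move=> PP' [D nzD DP]; exists D => // x Xx Dx; apply: PP' => //; apply: DP. Qed.

Lemma genI (P P' : pt -> Prop) : gen P -> gen P' -> gen (fun x => P x /\ P' x).
Proof.
move=> [D nzD DP] [E nzE EP]; exists (D * E) => [|x Xx]; first exact: nzXM.
rewrite mevalM mulf_eq0 negb_or => /andP[Dx Ex].
by split; [exact: DP | exact: EP].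
Qed.

Lemma genT (P : pt -> Prop) : (forall x, onX x -> P x) -> gen P.
Proof. by move=> XP; exists 1; [exact: nzX1 | move=> x Xx _; exact: XP]. Qed.

Lemma gen_ex (P : pt -> Prop) : gen P -> exists2 x, onX x & P x.
Proof. by move=> [D [x Xx Dx] DP]; exists x => //; exact: DP. Qed.

Lemma gen_nz D : nzX D -> gen (fun x => D.@[x] != 0).
Proof. by move=> nzD; exists D. Qed.

Lemma gen_base (r : {poly k}) : r != 0 -> gen (fun x => r.[base x] != 0).
Proof.
move=> /nzX_base/gen_nz; apply: genS => x _.
by rewrite meval_horner meval_base_mp.
Qed.

Lemma gen_base_neq t : gen (fun x => base x != t).
Proof.
have := gen_base (r := 'X - t%:P); rewrite polyXsubC_eq0 => /(_ isT).
by apply: genS => x _; rewrite hornerXsubC subr_eq0.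
Qed.

Lemma gen_eq0 Q : gen (fun x => Q.@[x] = 0) -> forall x, onX x -> Q.@[x] = 0.
Proof.
move=> gQ x Xx; apply/eqP; apply: contraT => Qx.
have [y _ [Qy]] := gen_ex (genI gQ (gen_nz (ex_intro2 _ _ x Xx Qx))).
by rewrite Qy eqxx.
Qed.

Lemma gen_eq Q R : gen (fun x => Q.@[x] = R.@[x]) -> forall x, onX x -> Q.@[x] = R.@[x].
Proof.
move=> gQR x Xx; apply/eqP; rewrite -subr_eq0 -mevalB; apply/eqP.
by apply: gen_eq0 Xx; apply: genS gQR => y _ /eqP; rewrite mevalB -subr_eq0 => /eqP.
Qed.

Lemma nzX_norm D : nzX D ->
  exists2 r : {poly k}, r != 0 & exists D', forall x, onX x -> D.@[x] * D'.@[x] = r.[base x].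
Proof.
move=> nzD; have [r Er] := norm_onX D; exists r; last first.
  exists (\prod_(s : 'S_n.+1 | s != 1%g) msym s D) => x /Er <-.
  rewrite [RHS](bigD1 1%g) //= act1 rmorph_prod; congr (_ * _).
  by apply: eq_bigr => s _ /=; rewrite meval_msym_act.
apply/eqP => r0; have /nzX_prod[x Xx] : forall s : 'S_n.+1, true -> nzX (msym s D).
  move=> s _; case: nzD => x Xx Dx; exists (act s^-1 x); first exact: onX_act.
  by rewrite meval_msym_act actKV.
rewrite rmorph_prod; under eq_bigr do rewrite /= meval_msym_act.
by rewrite Er // r0 horner0 eqxx.
Qed.

(** One zero per fibre, on infinitely many fibres, is enough: a nonzero Q divides a nonzero
    polynomial in s, its norm. *)
Lemma gen_base_zero Q : (forall r : {poly k}, r != 0 ->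
    exists x, [/\ onX x, r.[base x] != 0 & Q.@[x] = 0]) ->
  forall x, onX x -> Q.@[x] = 0.
Proof.
move=> Qz x Xx; apply/eqP; apply: contraT => Qx.
have [r r0 [D Dr]] := nzX_norm (ex_intro2 _ _ x Xx Qx).
have [y [Xy ry Qy]] := Qz r r0.
by rewrite -Dr // Qy mul0r eqxx in ry.
Qed.

(** The value at q of the rational function that F represents, read from a fraction defined at q;
    the number F q itself does not enter. *)
Definition has_val q F t : Prop := exists a b,
  [/\ b.@[q] != 0, a.@[q] = t * b.@[q] & gen (fun x => F x * b.@[x] = a.@[x])].

Definition pole q F : Prop := exists a b,
  [/\ b.@[q] = 0, a.@[q] != 0 & gen (fun x => F x * b.@[x] = a.@[x])].

Definition rat F : Prop := exists a b, nzX b /\ gen (fun x => F x * b.@[x] = a.@[x]).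

Lemma val_uniq q F t t' : onX q -> has_val q F t -> has_val q F t' -> t = t'.
Proof.
move=> Xq [a [b [bq aq Fa]]] [a' [b' [bq' aq' Fa']]].
have /gen_eq/(_ q Xq) : gen (fun x => (a * b').@[x] = (a' * b).@[x]).
  by apply: genS (genI Fa Fa') => x _ [E1 E2]; rewrite !mevalM -E1 -E2; ring.
rewrite !mevalM aq aq' -!mulrA [b'.@[q] * _]mulrC.
by move/(mulIf (mulf_neq0 bq bq')).
Qed.

Lemma val_gen q F G t : gen (fun x => F x = G x) -> has_val q F t -> has_val q G t.
Proof.
move=> FG [a [b [bq aq Fa]]]; exists a, b; split=> //.
by apply: genS (genI FG Fa) => x _ [<-].
Qed.

Lemma val_pole q F t : onX q -> has_val q F t -> pole q F -> False.
Proof.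
move=> Xq [a [b [bq aq Fa]]] [a' [b' [bq' aq' Fa']]].
have /gen_eq/(_ q Xq)/eqP : gen (fun x => (a * b').@[x] = (a' * b).@[x]).
  by apply: genS (genI Fa Fa') => x _ [E1 E2]; rewrite !mevalM -E1 -E2; ring.
by rewrite !mevalM bq' mulr0 eq_sym mulf_eq0 (negbTE bq) (negbTE aq').
Qed.

Lemma val_meval q Q : has_val q (fun x => Q.@[x]) Q.@[q].
Proof.
exists Q, 1; rewrite meval1 oner_neq0 mulr1; split=> //.
by apply: genT => x _; rewrite meval1 mulr1.
Qed.

Lemma val_const q c : has_val q (fun=> c) c.
Proof.
have := val_meval q c%:MP; rewrite mevalC; apply: val_gen.
by apply: genT => x _; rewrite mevalC.
Qed.

Lemma valD q F G t u : has_val q F t -> has_val q G u -> has_val q (fun x => F x + G x) (t + u).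
Proof.
move=> [a [b [bq aq Fa]]] [a' [b' [bq' aq' Ga']]].
exists (a * b' + a' * b), (b * b'); rewrite !mevalM !mevalD !mevalM.
split; [by rewrite mulf_neq0 | by rewrite aq aq'; ring |].
by apply: genS (genI Fa Ga') => x _ [E1 E2]; rewrite mevalD !mevalM -E1 -E2; ring.
Qed.

Lemma valM q F G t u : has_val q F t -> has_val q G u -> has_val q (fun x => F x * G x) (t * u).
Proof.
move=> [a [b [bq aq Fa]]] [a' [b' [bq' aq' Ga']]].
exists (a * a'), (b * b'); rewrite !mevalM.
split; [by rewrite mulf_neq0 | by rewrite aq aq'; ring |].
by apply: genS (genI Fa Ga') => x _ [E1 E2]; rewrite !mevalM -E1 -E2; ring.
Qed.

Lemma val_sum q I (r : seq I) (F : I -> pt -> k) t : (forall i, has_val q (F i) (t i)) ->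
  has_val q (fun x => \sum_(i <- r) F i x) (\sum_(i <- r) t i).
Proof.
move=> Ft; elim: r => [|i r IHr].
  rewrite big_nil; apply: val_gen (val_const q 0).
  by apply: genT => x _; rewrite big_nil.
rewrite big_cons; apply: val_gen (valD (Ft i) IHr).
by apply: genT => x _; rewrite big_cons.
Qed.

Lemma val_prod q I (r : seq I) (F : I -> pt -> k) t : (forall i, has_val q (F i) (t i)) ->
  has_val q (fun x => \prod_(i <- r) F i x) (\prod_(i <- r) t i).
Proof.
move=> Ft; elim: r => [|i r IHr].
  rewrite big_nil; apply: val_gen (val_const q 1).
  by apply: genT => x _; rewrite big_nil.
rewrite big_cons; apply: val_gen (valM (Ft i) IHr).
by apply: genT => x _; rewrite big_cons.
Qed.

Lemma valX q F t m : has_val q F t -> has_val q (fun x => F x ^+ m) (t ^+ m).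
Proof.
move=> Ft; have := val_prod (iota 0 m) (fun=> Ft); rewrite big_const_seq.
rewrite count_predT size_iota iter_mulr_1; apply: val_gen; apply: genT => x _.
by rewrite big_const_seq count_predT size_iota iter_mulr_1.
Qed.

Lemma val_comp q m (P : {mpoly k[m]}) (F : 'I_m -> pt -> k) (r : 'I_m -> k) :
  (forall i, has_val q (F i) (r i)) -> has_val q (fun x => P.@[fun i => F i x]) P.@[r].
Proof.
move=> Fr; rewrite mevalE.
have /(@val_sum q _ (msupp P)) : forall c : 'X_{1..m},
    has_val q (fun x => P@_c * \prod_i F i x ^+ c i) (P@_c * \prod_i r i ^+ c i).
  by move=> c; apply: valM (val_const _ _) (val_prod _ _) => i; exact: valX.
by apply: val_gen; apply: genT => x _; rewrite mevalE.
Qed.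

Lemma val_horner q (c : {poly k}) F t : has_val q F t -> has_val q (fun x => c.[F x]) c.[t].
Proof.
move=> Ft; rewrite horner_coef.
have /(@val_sum q _ (index_enum 'I_(size c))) : forall i : 'I_(size c),
    has_val q (fun x => c`_i * F x ^+ i) (c`_i * t ^+ i).
  by move=> i; apply: valM (val_const _ _) (valX _ _).
by apply: val_gen; apply: genT => x _; rewrite horner_coef.
Qed.

(** * First-order expansions at unramified points *)

Section Derivative.
Variable q : pt.
Hypotheses (Xq : onX q) (dq : (delta k n).[base q] != 0).

(* First-order expansion at q with respect to the uniformiser s - s(q). *)
Definition der F f w : Prop := has_val q (fun x => (F x - f) / (base x - base q)) w.

Lemma base_val : has_val q (fun x => base x - base q) 0.
Proof.
have := val_meval q (base_mp k n - (base q)%:MP).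
rewrite mevalB meval_base_mp mevalC subrr; apply: val_gen; apply: genT => x _.
by rewrite mevalB meval_base_mp mevalC.
Qed.

Lemma der_val F f w : der F f w -> has_val q F f.
Proof.
move=> Ff; have := valD (valM Ff base_val) (val_const q f).
rewrite mulr0 add0r; apply: val_gen; apply: genS (gen_base_neq (base q)) => x _ xq.
by rewrite divfK ?subr_eq0 // subrK.
Qed.

Lemma der_gen F G f w : gen (fun x => F x = G x) -> der F f w -> der G f w.
Proof. by move=> FG; apply: val_gen; apply: genS FG => x _ ->. Qed.

Lemma der_const c : der (fun=> c) c 0.
Proof.
apply: val_gen (val_const q 0); apply: genT => x _.
by rewrite subrr mul0r.
Qed.

Lemma derD F G f g v w : der F f v -> der G g w ->
  der (fun x => F x + G x) (f + g) (v + w).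
Proof.
move=> Ff Gg; apply: val_gen (valD Ff Gg); apply: genT => x _.
by rewrite -mulrDl; congr (_ / _); ring.
Qed.

Lemma derM F G f g v w : der F f v -> der G g w ->
  der (fun x => F x * G x) (f * g) (v * g + f * w).
Proof.
move=> Ff Gg; have := valD (valM Ff (der_val Gg)) (valM (val_const q f) Gg).
by apply: val_gen; apply: genT => x _; rewrite mulrAC mulrA -mulrDl; congr (_ / _); ring.
Qed.

Lemma der_inv F f w : der F f w -> f != 0 ->
  exists v, der (fun x => (F x)^-1) f^-1 v.
Proof.
move=> Ff f0; have [a [b [bq aq Fa]]] := der_val Ff.
have aq0 : a.@[q] != 0 by rewrite aq mulf_neq0.
have gF : gen (fun x => F x != 0).
  apply: genS (genI Fa (gen_nz (ex_intro2 _ _ q Xq aq0))) => x _ [<-].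
  by apply: contraNneq => ->; rewrite mul0r.
have vF : has_val q (fun x => (F x)^-1) f^-1.
  exists b, a; rewrite aq mulKf //; split=> //; first by rewrite -aq.
  by apply: genS (genI Fa gF) => x _ [<- Fx]; rewrite mulKf.
exists (- f^-1 * (f^-1 * w)); have := valM (val_const q (- f^-1)) (valM vF Ff).
apply: val_gen; apply: genS (genI gF (gen_base_neq (base q))) => x _ [Fx].
by rewrite -subr_eq0 => xq; field; rewrite f0 Fx xq.
Qed.

(** Writing trin z - trin q_i = g(z) (z - q_i), the difference quotient is 1/g(x_i), and g(q_i) is
    the derivative, nonzero at an unramified point. *)
Lemma der_coord i : der (fun x => x i) (q i) (dtrin n (q i))^-1.
Proof.
have [g Eg] : exists g, trin_poly k n - (trin n (q i))%:P = g * ('X - (q i)%:P).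
  by apply/factor_theorem; rewrite /root hornerD hornerN hornerC horner_trin_poly subrr.
have gq : g.[q i] = dtrin n (q i).
  rewrite -horner_dtrin_poly -deriv_trin_poly -[trin_poly k n](subrK (trin n (q i))%:P) Eg.
  by rewrite derivD derivC addr0 derivM derivXsubC !hornerE subrr mulr0 add0r.
have fq := delta_dtrin k0 n_gt0 i Xq dq.
exists 1, (mhorner g 'X_i); rewrite meval_horner mevalXU meval1 gq mulVf //; split=> //.
apply: genS (gen_base_neq (base q)) => x Xx xq.
have := congr1 (horner^~ (x i)) Eg.
rewrite hornerD hornerN hornerC horner_trin_poly hornerM hornerXsubC !onX_trin // => Ex.
by rewrite meval_horner mevalXU meval1 mulrAC [_ * g.[_]]mulrC -Ex divff ?subr_eq0.
Qed.

Lemma der_comp m (P : {mpoly k[m]}) (F : 'I_m -> pt -> k) (f w : 'I_m -> k) :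
  (forall i, der (F i) (f i) (w i)) ->
  der (fun x => P.@[fun i => F i x]) P.@[f] (\sum_i P^`M(i).@[f] * w i).
Proof.
move=> Fd.
pose S (P : {mpoly k[m]}) := der (fun x => P.@[fun i => F i x]) P.@[f]
  (\sum_i P^`M(i).@[f] * w i).
have SC c : S c%:MP.
  rewrite /S mevalC big1 => [|i _]; last by rewrite mderivC meval0 mul0r.
  by apply: der_gen (der_const c); apply: genT => x _; rewrite mevalC.
have SX i : S 'X_i.
  rewrite /S mevalXU (bigD1 i) //= big1 ?addr0 => [|j ji].
    rewrite mderivX mnm1E eqxx scale1r (_ : (U_(i) - U_(i))%MM = 0%MM); last first.
      by apply/mnmP => j; rewrite mnmBE mnm0E subnn.
    rewrite mpolyX0 meval1 mul1r.
    by apply: der_gen (Fd i); apply: genT => x _; rewrite mevalXU.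
  by rewrite mderivX mnm1E eq_sym (negbTE ji) scale0r meval0 mul0r.
have SD P1 P2 : S P1 -> S P2 -> S (P1 + P2).
  move=> S1 S2; rewrite /S mevalD.
  under eq_bigr do rewrite mderivD mevalD mulrDl.
  rewrite big_split; apply: der_gen (derD S1 S2).
  by apply: genT => x _; rewrite mevalD.
have SM P1 P2 : S P1 -> S P2 -> S (P1 * P2).
  move=> S1 S2; rewrite /S mevalM.
  have -> : \sum_i (P1 * P2)^`M(i).@[f] * w i =
      (\sum_i P1^`M(i).@[f] * w i) * P2.@[f] + P1.@[f] * \sum_i P2^`M(i).@[f] * w i.
    rewrite mulr_suml mulr_sumr -big_split; apply: eq_bigr => i _ /=.
    by rewrite mderivM mevalD !mevalM; ring.
  apply: der_gen (derM S1 S2).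
  by apply: genT => x _; rewrite mevalM.
elim/mpolyind: P => [|c u P _ _ SP]; first exact: (SC 0).
apply: (SD) => //; rewrite -mul_mpolyC; apply: (SM) => //.
rewrite mpolyXE_id; elim/big_ind: _ => [||i _]; [exact: (SC 1) | exact: SM |].
elim: (u i) => [|v IHv]; first by rewrite expr0; exact: (SC 1).
by rewrite exprS; apply: SM.
Qed.

Lemma der_meval Q : der (fun x => Q.@[x]) Q.@[q] (\sum_i Q^`M(i).@[q] * (dtrin n (q i))^-1).
Proof. by apply: der_comp => i; exact: der_coord. Qed.

(** The local ring at q is a valuation ring. The norm turns the denominator into a polynomial in s,
    a unit at q times (s - s(q))^m, and [der_meval] cancels one factor each time the numerator
    vanishes at q. *)
Lemma val_or_pole F : rat F -> (exists t, has_val q F t) \/ pole q F.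
Proof.
move=> [a [b [/nzX_norm[r r0 [b' Er]] Fa]]].
have [m [r1 /=]] := multiplicity_XsubC r (base q); rewrite r0 /= => rq Err.
have : gen (fun x => F x * (mhorner r1 (base_mp k n)).@[x] * (base x - base q) ^+ m =
    (a * b').@[x]).
  apply: genS Fa => x Xx Fx.
  by rewrite mevalM -Fx -mulrA -mulrA Er // Err meval_horner meval_base_mp !hornerE.
have : (mhorner r1 (base_mp k n)).@[q] != 0 by rewrite meval_horner meval_base_mp.
elim: m {a b b' Er Fa rq Err} (a * b') (mhorner r1 _) => [|m IHm] a b bq Fa.
  left; exists (a.@[q] / b.@[q]), a, b; rewrite divfK //; split=> //.
  by apply: genS Fa => x _ <-; rewrite expr0 mulr1.
have [aq|aq] := eqVneq a.@[q] 0; last first.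
  right; exists a, (b * (base_mp k n - (base q)%:MP) ^+ m.+1); split=> //.
    by rewrite mevalM rmorphXn /= mevalB meval_base_mp mevalC subrr expr0n mulr0.
  apply: genS Fa => x _ <-.
  by rewrite mevalM rmorphXn /= mevalB meval_base_mp mevalC mulrA.
have := der_meval a; rewrite aq => -[a' [e [eq _ Ea]]].
apply: (IHm a' (b * e)); first by rewrite mevalM mulf_neq0.
apply: genS (genI (genI Fa Ea) (gen_base_neq (base q))) => x _ [[Fx Ex]].
rewrite -subr_eq0 => xq; rewrite -Ex subr0 -Fx mevalM exprS.
by field.
Qed.

End Derivative.

Lemma trin_reduce m : exists c : 'I_n.+1 -> {poly k},
  forall z, z ^+ m = \sum_j (c j).[trin n z] * z ^+ j.
Proof.
elim/ltn_ind: m => m IHm; have [mn|nm] := ltnP m n.+1.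
  exists (fun j => (j == Ordinal mn)%:R%:P) => z.
  rewrite (bigD1 (Ordinal mn)) //= eqxx hornerC mul1r big1 ?addr0 // => j /negbTE->.
  by rewrite hornerC mul0r.
have [c Ec] := IHm (m - n.+1)%N ltac:(lia).
have [c' Ec'] := IHm (m - n)%N ltac:(lia).
exists (fun j => 'X * c j + c' j) => z.
under eq_bigr do rewrite hornerD hornerM hornerX mulrDl -mulrA.
rewrite big_split /= -mulr_sumr -Ec -Ec' /trin mulrBl -exprD -exprS.
by rewrite subnKC // (_ : (m - n.+1).+1 = m - n)%N ?subrK //; lia.
Qed.

(* The coordinate ring of the curve is generated, as a module over the
   polynomials in s, by the monomials with exponents at most n. *)
Definition span_dim : nat := #|{ffun 'I_n.+1 -> 'I_n.+1}|.

Lemma span_onX (Q : mp) : exists c : {ffun 'I_n.+1 -> 'I_n.+1} -> {poly k},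
  forall x : pt, onX x -> Q.@[x] = \sum_u (c u).[base x] * \prod_i x i ^+ u i.
Proof.
have /choice[C EC] := trin_reduce.
exists (fun u => \sum_(m <- msupp Q) Q@_m *: \prod_i C (m i) (u i)) => x Xx.
rewrite mevalE.
under [RHS]eq_bigr do rewrite horner_sum mulr_suml.
rewrite exchange_big /=; apply: eq_bigr => m _.
under eq_bigr => i _ do rewrite (EC (m i)).
rewrite bigA_distr_bigA mulr_sumr; apply: eq_bigr => u _ /=.
rewrite hornerZ horner_prod -mulrA -big_split; congr (_ * _).
by apply: eq_bigr => i _; rewrite onX_trin.
Qed.

(** Linear dependence over the polynomials in s; common factors s - t are divided out so that the
    relation stays nontrivial when s is specialised to t. *)
Lemma relation_onX (g : 'I_span_dim.+1 -> mp) (t : k) :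
  exists c : 'I_span_dim.+1 -> {poly k}, (exists i, (c i).[t] != 0) /\
    forall x : pt, onX x -> \sum_i (c i).[base x] * (g i).@[x] = 0.
Proof.
have /fin_all_exists[v Ev] := fun i => span_onX (g i).
have [c [[i ci] Ec]] := linear_relation (fun i (j : 'I_span_dim) => v i (enum_val j)).
have relc x : onX x -> \sum_i (c i).[base x] * (g i).@[x] = 0.
  move=> Xx; under eq_bigr do rewrite Ev // mulr_sumr.
  rewrite exchange_big big1 //= => u _.
  have E : \sum_j (c j).[base x] * (v j u).[base x] = 0.
    rewrite -[RHS](horner0 (base x)) -(Ec (enum_rank u)) horner_sum.
    by apply: eq_bigr => j _; rewrite hornerM enum_rankK.
  under eq_bigr do rewrite mulrA.
  by rewrite -mulr_suml E mul0r.
have [m] := ubnP (size (c i)); elim: m c ci relc {Ec} => // m IHm c ci relc cm.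
have [[j cj]|nc] := pselect (exists j, (c j).[t] != 0); first by exists c; split=> //; exists j.
have /fin_all_exists[c' Ec'] : forall j, exists r : {poly k}, c j = r * ('X - t%:P).
  move=> j; apply/factor_theorem; apply/rootP/eqP; apply: contraT => cj.
  by case: nc; exists j.
apply: (IHm c').
- by apply: contraNneq ci => ci; rewrite Ec' ci mul0r.
- move=> x Xx; pose Q : mp := \sum_i mhorner (c' i) (base_mp k n) * g i.
  have EQ (y : pt) : Q.@[y] = \sum_i (c' i).[base y] * (g i).@[y].
    rewrite raddf_sum; apply: eq_bigr => j _ /=.
    by rewrite mevalM meval_horner meval_base_mp.
  rewrite -EQ; apply: gen_eq0 Xx.
  apply: genS (gen_base_neq t) => y Xy; rewrite -subr_eq0 => yt.
  have := relc y Xy; under eq_bigr do rewrite Ec' hornerM hornerXsubC mulrAC.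
  by rewrite -mulr_suml -EQ => /eqP; rewrite mulf_eq0 (negbTE yt) orbF => /eqP.
- move: cm; rewrite Ec' size_Mmonic ?monicXsubC // ?size_XsubC ?addn2 //.
  by apply: contraNneq ci => ci; rewrite Ec' ci mul0r.
Qed.


Lemma gen_all (I : finType) (P : I -> pt -> Prop) :
  (forall i, gen (P i)) -> gen (fun x => forall i, P i x).
Proof.
move=> /fin_all_exists2[E nzE EP]; exists (\prod_i E i); first exact: nzX_prod.
move=> x Xx; rewrite rmorph_prod => /prodf_neq0 Ex i.
by apply: EP => //; exact: Ex.
Qed.

Lemma pole_gen q F G : gen (fun x => F x = G x) -> pole q F -> pole q G.
Proof.
move=> FG [a [b [bq aq Fa]]]; exists a, b; split=> //.
by apply: genS (genI FG Fa) => x _ [<-].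
Qed.

(** Ensures that all coordinates of phi stay finite wherever s o phi does. *)
Lemma pole_trin q F : pole q F -> pole q (fun x => trin n (F x)).
Proof.
move=> [a [b [bq aq Fa]]]; exists (a ^+ n.+1 - a * b ^+ n), (b ^+ n.+1).
have b0 : b.@[q] ^+ n = 0 by rewrite bq expr0n gtn_eqF.
rewrite mevalB mevalM !rmorphXn /= b0 exprS b0 !mulr0 subr0 expf_neq0 //.
split=> //; apply: genS Fa => x _ E; rewrite mevalB mevalM !rmorphXn /= -E /trin.
by rewrite !exprMn !exprS; ring.
Qed.

Lemma rat_cases F : rat F -> gen (fun x => F x = 0) \/ gen (fun x => F x != 0).
Proof.
move=> [a [b [nzb Fa]]]; have [nza|za] := pselect (nzX a).
  right; apply: genS (genI Fa (gen_nz nza)) => x _ [<-].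
  by apply: contraNneq => ->; rewrite mul0r.
left; apply: genS (genI Fa (gen_nz nzb)) => x Xx [E bx].
apply/eqP; apply: contraT => Fx; case: za; exists x => //.
by rewrite -E mulf_neq0.
Qed.

(** * Automorphisms of open subsets *)

Definition Xh (h : mp) x : Prop := onX x /\ h.@[x] != 0.

Definition reg (h : mp) F : Prop :=
  exists a N, forall x, Xh h x -> F x * h.@[x] ^+ N = a.@[x].

Lemma gen_Xh h : nzX h -> gen (Xh h).
Proof. by move=> /gen_nz; apply: genS => x Xx hx; split. Qed.

Section Regular.
Variable h : mp.

Lemma reg_ext F G : (forall x, Xh h x -> F x = G x) -> reg h F -> reg h G.
Proof. by move=> FG [a [N E]]; exists a, N => x Xx; rewrite -FG ?E. Qed.

Lemma reg_meval Q : reg h (fun x => Q.@[x]).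
Proof. by exists Q, 0%N => x _; rewrite mulr1. Qed.

Lemma reg_const c : reg h (fun=> c).
Proof. by exists c%:MP, 0%N => x _; rewrite mulr1 mevalC. Qed.

Lemma regD F G : reg h F -> reg h G -> reg h (fun x => F x + G x).
Proof.
move=> [a [N Ea]] [b [M Eb]]; exists (a * h ^+ M + b * h ^+ N), (N + M)%N => x Xx.
by rewrite mevalD !mevalM !rmorphXn /= -Ea // -Eb // exprD; ring.
Qed.

Lemma regM F G : reg h F -> reg h G -> reg h (fun x => F x * G x).
Proof.
move=> [a [N Ea]] [b [M Eb]]; exists (a * b), (N + M)%N => x Xx.
by rewrite !mevalM -Ea // -Eb // exprD; ring.
Qed.

Lemma reg_sum I (r : seq I) (F : I -> pt -> k) :
  (forall i, reg h (F i)) -> reg h (fun x => \sum_(i <- r) F i x).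
Proof.
move=> Fr; elim: r => [|i r IHr].
  by apply: reg_ext (reg_const 0) => x _; rewrite big_nil.
by apply: reg_ext (regD (Fr i) IHr) => x _; rewrite big_cons.
Qed.

Lemma reg_prod I (r : seq I) (F : I -> pt -> k) :
  (forall i, reg h (F i)) -> reg h (fun x => \prod_(i <- r) F i x).
Proof.
move=> Fr; elim: r => [|i r IHr].
  by apply: reg_ext (reg_const 1) => x _; rewrite big_nil.
by apply: reg_ext (regM (Fr i) IHr) => x _; rewrite big_cons.
Qed.

Lemma regX F m : reg h F -> reg h (fun x => F x ^+ m).
Proof.
move=> Fr; elim: m => [|m IHm]; first by apply: reg_ext (reg_const 1).
by apply: reg_ext (regM Fr IHm) => x _; rewrite exprS.
Qed.

Lemma reg_comp m (P : {mpoly k[m]}) (F : 'I_m -> pt -> k) :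
  (forall i, reg h (F i)) -> reg h (fun x => P.@[fun i => F i x]).
Proof.
move=> Fr; apply: reg_ext (fun x _ => esym (mevalE _ _)) _.
by apply: reg_sum => u; apply: regM (reg_const _) (reg_prod _ _) => i; exact: regX.
Qed.

Lemma reg_horner (c : {poly k}) F : reg h F -> reg h (fun x => c.[F x]).
Proof.
move=> Fr; apply: reg_ext (fun x _ => esym (horner_coef _ _)) _.
by apply: reg_sum => i; apply: regM (reg_const _) (regX _ _).
Qed.

Lemma reg_horner2 (u : {poly {poly k}}) F G : reg h F -> reg h G ->
  reg h (fun x => u.[F x, G x]).
Proof.
move=> Fr Gr; pose H x := \sum_(i < size u) (u`_i).[G x] * F x ^+ i.
apply: (@reg_ext H) => [x _|].
  by rewrite horner2_coef.
by apply: reg_sum => i; apply: regM (reg_horner _ Gr) (regX _ Fr).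
Qed.

Lemma reg_val q F : Xh h q -> reg h F -> has_val q F (F q).
Proof.
move=> [Xq hq] [a [N Ea]]; exists a, (h ^+ N); rewrite rmorphXn /= Ea //.
split=> //; first by rewrite expf_neq0.
apply: genS (gen_Xh (ex_intro2 _ _ q Xq hq)) => x _ Xx.
by rewrite rmorphXn /= Ea.
Qed.

Hypothesis nzh : nzX h.

Lemma reg_rat F : reg h F -> rat F.
Proof.
move=> [a [N Ea]]; exists a, (h ^+ N); split.
  by elim: N {Ea} => [|N IHN]; rewrite ?exprS; [exact: nzX1 | exact: nzXM].
by apply: genS (gen_Xh nzh) => x _ Xx; rewrite rmorphXn /= Ea.
Qed.

Lemma reg_eq0 F : reg h F -> gen (fun x => F x = 0) -> forall x, Xh h x -> F x = 0.
Proof.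
move=> Fr F0 x Xx; apply: (val_uniq Xx.1 (reg_val Xx Fr)).
apply: val_gen (val_const x 0).
by apply: genS F0 => y _ ->.
Qed.

End Regular.

Lemma reg_sub h h' F : reg h F -> reg (h * h') F.
Proof.
move=> [a [N Ea]]; exists (a * h' ^+ N), N => x [Xx].
rewrite !mevalM mulf_eq0 negb_or => /andP[hx h'x].
by rewrite rmorphXn /= exprMn mulrA Ea.
Qed.

Lemma reg_subr h h' F : reg h' F -> reg (h * h') F.
Proof. by move=> /reg_sub; rewrite mulrC; apply. Qed.

Definition isaut h (phi psi : pt -> pt) : Prop :=
  [/\ forall x, Xh h x -> Xh h (phi x), forall x, Xh h x -> Xh h (psi x),
      forall x, Xh h x -> psi (phi x) = x & forall x, Xh h x -> phi (psi x) = x] /\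
  (forall i, reg h (fun x => phi x i)) /\ (forall i, reg h (fun x => psi x i)).

(** * Values and poles of s composed with an automorphism *)

Section Automorphism.
Variables (h : mp) (phi psi : pt -> pt).
Hypotheses (nzh : nzX h) (aut : isaut h phi psi).

Lemma reg_aut Q : reg h (fun x => Q.@[phi x]).
Proof. by apply: (@reg_comp h _ Q (fun i x => phi x i)) => i; case: aut => _ []. Qed.

Lemma reg_aut_inv Q : reg h (fun x => Q.@[psi x]).
Proof. by apply: (@reg_comp h _ Q (fun i x => psi x i)) => i; case: aut => _ []. Qed.

Lemma reg_base_aut : reg h (fun x => base (phi x)).
Proof. by apply: reg_ext (reg_aut (base_mp k n)) => x _; rewrite meval_base_mp. Qed.

Lemma base_aut_transcendental (c : {poly k}) : gen (fun x => c.[base (phi x)] = 0) -> c = 0.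
Proof.
case: aut => -[_ psiX _ phiK] _.
move=> /(reg_eq0 (reg_horner _ reg_base_aut)) c0; apply/eqP; apply: contraT => cn0.
have [x _ [Xx cx]] := gen_ex (genI (gen_Xh nzh) (gen_base cn0)).
by have := c0 _ (psiX x Xx); rewrite phiK // => /eqP; rewrite (negbTE cx).
Qed.

(** The bound on the degree over k(s) transfers to k(s o phi): [relation_onX] is applied to the
    functions g o psi, cleared of denominators, and pulled back along phi. *)
Lemma relation_aut (g : 'I_span_dim.+1 -> mp) (t : k) :
  exists c : 'I_span_dim.+1 -> {poly k}, (exists i, (c i).[t] != 0) /\
    forall x, Xh h x -> \sum_i (c i).[base (phi x)] * (g i).@[x] = 0.
Proof.
have /fin_all_exists[b /fin_all_exists[N Eb]] := fun i => reg_aut_inv (g i).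
pose M := (\sum_i N i)%N.
have NM i : (N i <= M)%N by rewrite /M (bigD1 i) //= leq_addr.
have [c [ct Ec]] := relation_onX (fun i => b i * h ^+ (M - N i)) t.
exists c; split=> // x Xx; case: aut => -[phiX psiX phiK _] _.
have := Ec _ (phiX x Xx).1.
have E i : (b i * h ^+ (M - N i)).@[phi x] = (g i).@[x] * h.@[phi x] ^+ M.
  rewrite mevalM rmorphXn /= -Eb; last exact: phiX.
  by rewrite phiK // -mulrA -exprD subnKC.
under eq_bigr do rewrite E mulrA.
rewrite -mulr_suml => /eqP; rewrite mulf_eq0 => /orP[/eqP//|].
by rewrite expf_eq0 (negbTE (phiX x Xx).2) andbF.
Qed.

Lemma interpolation_family m (Q : 'I_m -> pt) : injective Q ->
  exists g : 'I_m -> mp, forall i j, (g i).@[Q j] = (i == j)%:R.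
Proof.
move=> Qinj; suff /fin_all_exists[g Eg] : forall i, exists u : mp, forall j,
    u.@[Q j] = (i == j)%:R by exists g.
move=> i.
have /interpolation[g [g1 g0]] : Q i \notin [seq Q j | j <- enum 'I_m & j != i].
  by apply/mapP => -[j]; rewrite mem_filter => /andP[ji _] /Qinj/esym/eqP; rewrite (negbTE ji).
exists g => j; have [<-|ij] := eqVneq i j; first by rewrite g1.
by rewrite g0 //; apply: map_f; rewrite mem_filter eq_sym ij mem_enum.
Qed.

Lemma subfamily m (Q : 'I_m -> pt) (A : {set 'I_m}) d : injective Q ->
  (d < #|A|)%N -> exists2 f : 'I_d.+1 -> 'I_m, injective (Q \o f) & forall i, f i \in A.
Proof.
move=> Qinj dA; exists (fun i => enum_val (widen_ord dA i)) => [i j /Qinj/enum_val_inj|i].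
  by move=> e; apply/val_inj; exact: (congr1 (@nat_of_ord _) e).
exact: enum_valP.
Qed.

(** With more points, take functions g_i dual to them. The relation evaluated at the i-th point
    reduces to c_i(t) = 0, against its nontriviality at t. *)
Lemma val_count m (Q : 'I_m -> pt) (A : {set 'I_m}) t : injective Q ->
  (forall i, i \in A -> onX (Q i) /\ has_val (Q i) (fun x => base (phi x)) t) ->
  (#|A| <= span_dim)%N.
Proof.
move=> Qinj QA; rewrite leqNgt; apply/negP => /(subfamily Qinj)[f finj fA].
have [g Eg] := interpolation_family finj.
have [c [[i ci] Ec]] := relation_aut g t.
have [Xq vq] := QA _ (fA i).
have v0 : has_val (Q (f i)) (fun x => \sum_j (c j).[base (phi x)] * (g j).@[x]) 0.
  apply: val_gen (val_const _ 0); apply: genS (gen_Xh nzh) => x _ Xx.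
  by rewrite Ec.
have v1 : has_val (Q (f i)) (fun x => \sum_j (c j).[base (phi x)] * (g j).@[x])
    (\sum_j (c j).[t] * (g j).@[Q (f i)]).
  by apply: val_sum => j; apply: valM (val_horner _ vq) (val_meval _ _).
have := val_uniq Xq v0 v1; rewrite (bigD1 i) //= (Eg i i) eqxx mulr1 big1 ?addr0.
  by move/esym/eqP; rewrite (negbTE ci).
by move=> j ji; rewrite (Eg j i) (negbTE ji) mulr0.
Qed.

(** As for [val_count], at infinity: i is chosen with c_i of maximal degree M, the relation is
    multiplied by b^M, and at the pole only the leading coefficient of c_i times a^M remains. *)
Lemma pole_count m (Q : 'I_m -> pt) (A : {set 'I_m}) : injective Q ->
  (forall i, i \in A -> onX (Q i) /\ pole (Q i) (fun x => base (phi x))) ->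
  (#|A| <= span_dim)%N.
Proof.
move=> Qinj QA; rewrite leqNgt; apply/negP => /(subfamily Qinj)[f finj fA].
have [g Eg] := interpolation_family finj.
have [c [[i0 ci0] Ec]] := relation_aut g 0.
case: (arg_maxnP (fun i => size (c i)) (isT : xpredT i0)) => i _ imax.
have [Xq [a [b [bq aq Fa]]]] := QA _ (fA i).
have ci : c i != 0.
  apply: contraNneq ci0 => ci; have := imax i0 isT; rewrite /= ci size_poly0 leqn0.
  by rewrite size_poly_eq0 => /eqP ->; rewrite horner0.
have [M sM] : exists M, size (c i) = M.+1.
  by exists (size (c i)).-1; rewrite prednK // size_poly_gt0.
pose P : mp := \sum_j (\sum_(l < M.+1) (c j)`_l *: (a ^+ l * b ^+ (M - l))) * g j.
have P0 : gen (fun x => P.@[x] = 0).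
  apply: genS (genI (gen_Xh nzh) Fa) => x _ [Xx E].
  have -> : P.@[x] = b.@[x] ^+ M * \sum_j (c j).[base (phi x)] * (g j).@[x].
    rewrite raddf_sum mulr_sumr; apply: eq_bigr => j _ /=.
    rewrite mevalM mulrA; congr (_ * _); rewrite raddf_sum /=.
    have -> := @horner_coef_wide _ M.+1 (c j) (base (phi x)) ltac:(by rewrite -sM; exact: imax).
    rewrite mulr_sumr; apply: eq_bigr => l _.
    have -> : b.@[x] ^+ M = b.@[x] ^+ l * b.@[x] ^+ (M - l).
      by rewrite -exprD subnKC // -ltnS.
    rewrite mevalZ mevalM !rmorphXn /= -E exprMn; ring.
  by rewrite Ec ?mulr0.
have /eqP := gen_eq0 P0 Xq; rewrite raddf_sum (bigD1 i) //= [X in _ + X]big1 ?addr0; last first.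
  by move=> j ji; rewrite mevalM (Eg j i) (negbTE ji) mulr0.
rewrite mevalM (Eg i i) eqxx mulr1 raddf_sum big_ord_recr /= big1 ?add0r => [|l _].
  rewrite mevalZ mevalM !rmorphXn /= subnn mulr1 mulf_eq0 expf_eq0 (negbTE aq) andbF orbF.
  by have := lead_coef_eq0 (c i); rewrite lead_coefE sM /= => ->; rewrite (negbTE ci).
by rewrite mevalZ mevalM !rmorphXn /= bq expr0n subn_eq0 leqNgt ltn_ord !mulr0.
Qed.

(* A removed point at which [phi] stays finite cannot be sent to a point of
   the curve, since [psi] would send it back. *)
Lemma val_removed q t : onX q -> (delta k n).[base q] != 0 -> h.@[q] = 0 ->
  has_val q (fun x => base (phi x)) t -> exists r, [/\ onX r, h.@[r] = 0 & base r = t].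
Proof.
move=> Xq dq hq vt; case: (aut) => -[phiX psiX phiK _] [phir psir].
have /fin_all_exists[r0 vr0] : forall i, exists t, has_val q (fun x => phi x i) t.
  move=> i; have [//|/pole_trin po] := val_or_pole Xq dq (reg_rat nzh (phir i)).
  case: (val_pole Xq vt); apply: pole_gen po; apply: genS (gen_Xh nzh) => x _ /phiX[Xx _].
  exact: onX_trin.
pose r : pt := [ffun i => r0 i].
have vr i : has_val q (fun x => phi x i) (r i) by rewrite ffunE.
have vQ Q : has_val q (fun x => Q.@[phi x]) Q.@[r].
  exact: (@val_comp q _ Q (fun i x => phi x i)).
have sr : base r = t.
  apply: val_uniq Xq _ vt; rewrite -meval_base_mp; apply: val_gen (vQ (base_mp k n)).
  by apply: genT => x _; rewrite meval_base_mp.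
have Xr : onX r.
  move=> z; have v1 := vQ ((trin n z)%:MP - base_mp k n).
  have v2 := vQ (\prod_i (z%:MP - 'X_i)).
  have -> : \prod_i (z - r i) = (\prod_i (z%:MP - 'X_i)).@[r].
    by rewrite rmorph_prod; apply: eq_bigr => i _; rewrite /= mevalB mevalC mevalXU.
  have -> : trin n z - base r = ((trin n z)%:MP - base_mp k n).@[r].
    by rewrite mevalB mevalC meval_base_mp.
  apply: (val_uniq Xq v2); apply: val_gen v1.
  apply: genS (gen_Xh nzh) => x _ /phiX[Xx _].
  rewrite mevalB mevalC meval_base_mp -(Xx z) rmorph_prod.
  by apply: eq_bigr => i _; rewrite /= mevalB mevalC mevalXU.
exists r; split=> //; apply/eqP; apply: contraT => hr.
have {}Xr : Xh h r by [].
suff E : psi r = q by have := (psiX r Xr).2; rewrite E hq eqxx.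
apply/ffunP => i; have [a [N Ea]] := psir i.
have := vQ a; have := valM (val_meval q 'X_i) (vQ (h ^+ N)).
rewrite mevalXU rmorphXn /= -(Ea r Xr) => v1 v2.
have /mulIf := expf_neq0 N hr; apply; symmetry; apply: (val_uniq Xq v1).
apply: val_gen v2; apply: genS (gen_Xh nzh) => x _ Xx.
by rewrite -Ea ?phiK ?mevalXU ?rmorphXn //; exact: phiX.
Qed.

(** Pointwise phi agrees with some permutation. If it differed from each of them somewhere,
    irreducibility would give one point where it differs from all. *)
Lemma aut_over_line : (forall x, Xh h x -> base (phi x) = base x) ->
  exists s, forall x, Xh h x -> phi x = act s x.
Proof.
move=> sphi; case: (aut) => -[phiX _ _ _] [phir _].
have regd s i : reg h (fun x => phi x i - x (s i)).
  apply: reg_ext (regD (phir i) (reg_meval h (- 'X_(s i)))) => x _.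
  by rewrite mevalN mevalXU.
apply: contrapT => ns.
have : gen (fun x => forall s, phi x != act s x).
  apply: gen_all => s.
  have [[i ni]|alli] := pselect (exists i, gen (fun x => phi x i - x (s i) != 0)).
    apply: genS ni => x _; apply: contraNneq => ->.
    by rewrite ffunE subrr.
  case: ns; exists s => x Xx; apply/ffunP => i; rewrite ffunE; apply/eqP.
  rewrite -subr_eq0; apply/eqP; move: x Xx; apply: reg_eq0 => //.
  have [//|ni] := rat_cases (reg_rat nzh (regd s i)).
  by case: alli; exists i.
move=> /(genI (gen_Xh nzh))/gen_ex[x Xx [Hx nx]].
have [s Es] := fiber_act Xx (phiX x Hx).1 (esym (sphi x Hx)).
by have := nx s; rewrite Es eqxx.
Qed.

End Automorphism.

Lemma val_horner2 q (u : {poly {poly k}}) F G t t' : has_val q F t -> has_val q G t' ->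
  has_val q (fun x => u.[F x, G x]) u.[t, t'].
Proof.
move=> Ft Gt; rewrite horner2_coef.
have /(@val_sum q _ (index_enum 'I_(size u))) : forall i : 'I_(size u),
    has_val q (fun x => (u`_i).[G x] * F x ^+ i) ((u`_i).[t'] * t ^+ i).
  by move=> i; apply: valM (val_horner _ Gt) (valX _ Ft).
by apply: val_gen; apply: genT => x _; rewrite horner2_coef.
Qed.

(** * Comparison of two automorphisms *)

Section Rigidity.
Variables (h h' : mp) (phi psi phi' psi' : pt -> pt).
Hypotheses (nzh : nzX h) (nzh' : nzX h').
Hypotheses (aut : isaut h phi psi) (aut' : isaut h' phi' psi').

Lemma pair_relation : exists c : 'I_span_dim.+1 -> {poly k}, (exists i, c i != 0) /\
  gen (fun x => \sum_i (c i).[base (phi x)] * base (phi' x) ^+ i = 0).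
Proof.
have [a [N Ea]] := reg_base_aut aut'.
(* The relation is among the powers of s o phi'; these factors of h' give all of them the
   denominator h'^(N d). *)
have [c [[i ci] Ec]] := relation_aut aut
  (fun i => a ^+ i * h' ^+ (N * (span_dim - i))) 0.
exists c; split; first by exists i; apply: contraNneq ci => ->; rewrite horner0.
apply: genS (genI (gen_Xh nzh) (gen_Xh nzh')) => x _ [Xx Xx'].
have := Ec x Xx; have h'x := expf_neq0 (N * span_dim) Xx'.2.
have E (j : 'I_span_dim.+1) : (a ^+ j * h' ^+ (N * (span_dim - j))).@[x] =
    base (phi' x) ^+ j * h'.@[x] ^+ (N * span_dim) :> k.
  rewrite mevalM !rmorphXn /= -Ea // exprMn -mulrA -exprM -exprD -mulnDr.
  by rewrite subnKC // -ltnS.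
under eq_bigr do rewrite E mulrA.
by rewrite -mulr_suml => /eqP; rewrite mulf_eq0 (negbTE h'x) orbF => /eqP.
Qed.

End Rigidity.

(** If the two functions differ, a relation of bidegree (d, d) has nonzero diagonal. Each common
    value is one of at most 2d roots of the diagonal, and each is taken at most d times. *)
Lemma rigidity h phi psi h' phi' psi' m (Q : 'I_m -> pt) (A : {set 'I_m}) :
  nzX h -> nzX h' -> isaut h phi psi -> isaut h' phi' psi' ->
  injective Q -> (forall i, onX (Q i)) ->
  (forall i, i \in A -> exists t, has_val (Q i) (fun x => base (phi x)) t /\
                                  has_val (Q i) (fun x => base (phi' x)) t) ->
  (span_dim.*2 * span_dim < #|A|)%N ->
  gen (fun x => base (phi x) = base (phi' x)).
Proof.
move=> nzh nzh' aut aut' Qinj XQ QA cA; apply: contrapT => nuu'.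
pose U x := base (phi x); pose U' x := base (phi' x).
have rU : reg (h * h') U by apply: reg_sub; exact: reg_base_aut aut.
have rU' : reg (h * h') U' by apply: reg_subr; exact: reg_base_aut aut'.
have nzhh : nzX (h * h') by exact: nzXM.
pose P (u : {poly {poly k}}) := gen (fun x => u.[U' x, U x] = 0).
have [c [[i0 ci0] Ec]] := pair_relation nzh nzh' aut aut'.
have [c' [[i0' ci0'] Ec']] := pair_relation nzh' nzh aut' aut.
pose mk (f : 'I_span_dim.+1 -> {poly k}) : {poly {poly k}} :=
  \poly_(i < span_dim.+1) f (inord i).
have mk_size f : (size (mk f) <= span_dim.+1)%N by exact: size_poly.
have mk0 f (i : 'I_span_dim.+1) : f i != 0 -> mk f != 0.
  apply: contraNneq => f0; have := congr1 (fun u : {poly {poly k}} => u`_i) f0.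
  by rewrite coef_poly ltn_ord inord_val coef0 => ->.
have mkE f (t1 t2 : k) : (mk f).[t1, t2] = \sum_i (f i).[t2] * t1 ^+ i.
  rewrite horner_poly horner_sum; apply: eq_bigr => i _.
  by rewrite hornerM -rmorphXn hornerC inord_val.
have [|||||||||||u [Pu u0 su]] := @small_relation _ P span_dim (mk c) (swapXY (mk c')).
- move=> u u' Pu Pu'; apply: genS (genI Pu Pu') => x _ [E E'].
  by rewrite !hornerD E E' addr0.
- by move=> u u' Pu; apply: genS Pu => x _ E; rewrite !hornerM E mulr0.
- move=> u u' Puu'; have [|nz] := rat_cases (reg_rat nzhh (reg_horner2 u rU' rU)); first by left.
  right; apply: genS (genI Puu' nz) => x _ [+ /negbTE ux].
  by rewrite !hornerM => /eqP; rewrite mulf_eq0 ux => /eqP.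
- move=> f Pf; apply: (base_aut_transcendental nzh aut).
  by apply: genS Pf => x _; rewrite hornerC.
- move=> PXY; apply: nuu'; apply: genS PXY => x _.
  by rewrite !hornerE => /eqP; rewrite subr_eq0 => /eqP.
- exact: mk0 ci0.
- by apply: genS Ec => x _; rewrite mkE.
- exact: mk_size.
- by rewrite swapXY_eq0; exact: mk0 ci0'.
- by apply: genS Ec' => x _; rewrite horner2_swapXY mkE.
- by rewrite sizeYE swapXYK.
have /fin_all_exists[t Qt] : forall i, exists t, i \in A -> has_val (Q i) U t /\ has_val (Q i) U' t.
  move=> i; have [/QA[t vt]|_] := boolP (i \in A); first by exists t.
  by exists 0.
have [r Er] := closed_field_poly_normal u.['X].
have sr : (size r <= span_dim.*2)%N.
  by move: su; rewrite Er size_scale ?lead_coef_eq0 // size_prod_XsubC ltnS.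
have := card_fibers (t := t) (r := r) (d := span_dim) (A := A).
rewrite leqNgt (leq_ltn_trans _ cA) ?leq_mul2r ?sr ?orbT //.
move=> absurd; suff : false by []; apply: absurd => [i iA|z].
  have [vt vt'] := Qt i iA.
  rewrite -root_prod_XsubC -(rootZ _ _ (_ : lead_coef u.['X] != 0)) ?lead_coef_eq0 // -Er.
  rewrite /root horner_diag; apply/eqP/esym.
  have := val_horner2 u vt' vt; apply: (val_uniq (XQ i)).
  by apply: val_gen (val_const _ 0); apply: genS Pu => x _ ->.
apply: (val_count nzh aut (Q := Q) (t := z)) => // i; rewrite !inE => /andP[iA /eqP <-].
by split=> //; case: (Qt i iA).
Qed.

(** Starting from e, which in the fibre of p0 vanishes at p0 only, the product of its H-translates
    vanishes there exactly on the H-orbit of p0. *)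
Lemma orbit_function (H : {group 'S_n.+1}) (p0 : pt) : onX p0 -> injective p0 ->
  exists w : mp, [/\ nzX w, forall s, s \in H -> forall x, w.@[act s x] = w.@[x],
    w.@[p0] = 0 & forall s, s \notin H -> w.@[act s p0] = 1].
Proof.
move=> X0 inj0.
have free s : act s p0 = p0 -> s = 1%g.
  by move=> /ffunP e; apply/permP => i; apply: inj0; have := e i; rewrite ffunE perm1.
have /interpolation[f [f1 f0]] : p0 \notin [seq act s p0 | s <- enum {: 'S_n.+1} & s != 1%g].
  by apply/mapP => -[s]; rewrite mem_filter => /andP[s1 _] /esym/free/eqP; rewrite (negbTE s1).
pose e : mp := 1 - f.
have e0 : e.@[p0] = 0 by rewrite mevalB meval1 f1 subrr.
have e1 s : s != 1%g -> e.@[act s p0] = 1.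
  move=> s1; rewrite mevalB meval1 f0 ?subr0 //.
  by apply: map_f; rewrite mem_filter s1 mem_enum.
have wE x : (\prod_(g in H) msym g e).@[x] = \prod_(g in H) e.@[act g x].
  by rewrite rmorph_prod; apply: eq_bigr => g _; rewrite /= meval_msym_act.
exists (\prod_(g in H) msym g e); split.
- apply: nzX_prod => g _; pose t : 'S_n.+1 := tperm ord0 ord_max.
  exists (act (g^-1 * t) p0); first exact: onX_act.
  rewrite meval_msym_act -actM mulKVg e1 ?oner_neq0 //.
  apply/eqP => /permP/(_ ord0); rewrite tpermL perm1 => /(congr1 val) /= n0.
  by move: n_gt0; rewrite n0.
- move=> s sH x; rewrite !wE [RHS](reindex_inj (mulIg s)) /=.
  by apply: eq_big => [g|g _]; rewrite ?groupMr // actM.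
- by rewrite wE (bigD1 1%g) //= act1 e0 mul0r.
- move=> s sH; rewrite wE big1 // => g gH; rewrite -actM e1 //.
  apply: contraNneq sH => gs; rewrite -(groupMl _ gH) gs group1 //.
Qed.

Lemma rigid_open_curve (H : {group 'S_n.+1}) : exists h : mp,
  [/\ nzX h, forall x, Xh h x -> (delta k n).[base x] != 0,
      forall s, s \in H -> forall x, onX x -> h.@[act s x] = h.@[x] &
      forall phi psi, isaut h phi psi ->
        exists2 s, s \in H & forall x, Xh h x -> phi x = act s x].
Proof.
have d0 : delta k n != 0 := delta_neq0 n k0.
have [s0 ds0] := poly_nonroot d0.
have [p0 X0 sp0] := fiber_ex n_gt0 s0.
have inj0 : injective p0 by apply: (delta_inj k0 n_gt0 X0); rewrite sp0.
have [w [nzw Hw w0 w1]] := orbit_function H X0 inj0.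
have [nu nu0 [w' Ew]] := nzX_norm nzw.
(* At most 2d test points are lost to poles and to the value c; more than 2d^2 must remain for
   [rigidity]. *)
pose m := (span_dim.*2 + span_dim.*2 * span_dim).+1.
have Xs0 (c : k) : 'X - c%:P != 0 :> {poly k} by rewrite polyXsubC_eq0.
have [b [binj br]] := nonroots m (mulf_neq0 d0 (Xs0 s0)).
have bd i : (delta k n).[b i] != 0.
  by have := br i; rewrite hornerM mulf_eq0 negb_or => /andP[].
have bs i : b i != s0.
  by have := br i; rewrite hornerM mulf_eq0 negb_or hornerXsubC subr_eq0 => /andP[].
have /fin_all_exists2[Q XQ sQ] : forall i, exists2 x : pt, onX x & base x = b i.
  by move=> i; exact: fiber_ex n_gt0 (b i).
have Qinj : injective Q by move=> i j e; apply: binj; rewrite -!sQ e.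
pose beta := \prod_i ('X - (b i)%:P).
have betaE t : (beta.[t] == 0) = [exists i, t == b i].
  rewrite horner_prod; apply/prodf_eq0/existsP => -[i].
    by rewrite hornerXsubC subr_eq0; exists i.
  by move=> /eqP ->; exists i; rewrite // hornerXsubC subrr.
have beta0 : beta != 0 by apply/prodf_neq0.
pose h c : mp := mhorner (delta k n * beta * ('X - c%:P)) (base_mp k n) * w.
have hE c (x : pt) : (h c).@[x] =
    (delta k n).[base x] * beta.[base x] * (base x - c) * w.@[x].
  by rewrite mevalM meval_horner meval_base_mp !hornerM hornerXsubC.
have nzhc c : nzX (h c).
  by apply: nzXM => //; apply: nzX_base; rewrite !mulf_neq0.
have dhc c x : Xh (h c) x -> (delta k n).[base x] != 0.
  by move=> [_]; rewrite hE !mulf_eq0 !negb_or => /andP[/andP[/andP[]]].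
have Hhc c s : s \in H -> forall x, onX x -> (h c).@[act s x] = (h c).@[x].
  by move=> sH x Xx; rewrite !hE base_act // Hw.
(* If s were outside H, the point act s p0 would be kept (w is 1 there) while its preimage p0 is
   removed. *)
have overH c phi psi : c != s0 -> isaut (h c) phi psi ->
    (forall x, Xh (h c) x -> base (phi x) = base x) ->
    exists2 s, s \in H & forall x, Xh (h c) x -> phi x = act s x.
  move=> cs0 aut /(aut_over_line (nzhc c) aut)[s Es]; exists s => //.
  apply: contraT => sH; pose y := act s p0.
  have Xy : Xh (h c) y.
    split; first exact: onX_act.
    have bs0 : beta.[s0] != 0 by rewrite betaE; apply/existsPn => i; rewrite eq_sym.
    by rewrite hE base_act // sp0 w1 // mulr1 !mulf_neq0 // subr_eq0 eq_sym.
  case: aut => -[phiX psiX phiK psiK] _.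
  have := psiK y Xy; rewrite Es; last exact: psiX.
  move/(can_inj (actK s)) => e; have := (psiX y Xy).2.
  by rewrite e hE w0 mulr0 eqxx.
apply: contrapT => nh.
have bad c : c != s0 -> exists phi psi, isaut (h c) phi psi /\
    ~ (forall x, Xh (h c) x -> base (phi x) = base x).
  move=> cs0; apply: contrapT => np; apply: nh; exists (h c).
  split; [exact: nzhc | exact: dhc | exact: Hhc |].
  move=> phi psi aut; apply: (overH c phi psi) => //; apply: contrapT => nphi.
  by apply: np; exists phi, psi.
(* Its zeros contain the s-values of all removed points outside the fibre over c, the zeros of w
   being caught by the norm [nu]; it does not involve c. *)
pose rho := delta k n * nu * beta.
have rho0 : rho != 0 by rewrite !mulf_neq0.
have [rr Err] := closed_field_poly_normal rho.
have rrP t : (rho.[t] == 0) = (t \in rr).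
  by rewrite -[_ == 0]/(root _ _) Err rootZ ?lead_coef_eq0 // root_prod_XsubC.
have hzero c (x : pt) : onX x -> (h c).@[x] = 0 -> base x \in rr \/ base x = c.
  move=> Xx /eqP; rewrite hE !mulf_eq0 subr_eq0 -rrP !hornerM !mulf_eq0.
  move=> /orP[/orP[/orP[->|->]|/eqP ->]|wx]; rewrite ?orbT; auto.
  by left; rewrite -Ew // (eqP wx) mul0r eqxx orbT.
have hQ c i : (h c).@[Q i] = 0.
  rewrite hE sQ (_ : beta.[b i] = 0) ?mulr0 ?mul0r //.
  by apply/eqP; rewrite betaE; apply/existsP; exists i.
(* [None] stands for a pole or for the value c, so that the type of records is finite and
   independent of c. *)
pose D := {ffun 'I_m -> option (seq_sub rr)}.
have /choice[F /choice[F' /choice[dat Edat]]] : forall c, exists phi psi (d : D), c != s0 ->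
    [/\ isaut (h c) phi psi, ~ (forall x, Xh (h c) x -> base (phi x) = base x) &
     forall i, if d i is Some t then has_val (Q i) (fun x => base (phi x)) (ssval t)
       else pole (Q i) (fun x => base (phi x)) \/ has_val (Q i) (fun x => base (phi x)) c].
  move=> c; have [->|/bad[phi [psi [aut nphi]]]] := eqVneq c s0.
    by exists id, id, [ffun=> None].
  have /fin_all_exists[d Ed] : forall i, exists d : option (seq_sub rr),
      if d is Some t then has_val (Q i) (fun x => base (phi x)) (ssval t)
      else pole (Q i) (fun x => base (phi x)) \/ has_val (Q i) (fun x => base (phi x)) c.
    move=> i; have dQ : (delta k n).[base (Q i)] != 0 by rewrite sQ.
    have [[t vt]|po] := val_or_pole (XQ i) dQ (reg_rat (nzhc c) (reg_base_aut aut)); last first.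
      by exists None; left.
    have [r [Xr hr rt]] := val_removed (nzhc c) aut (XQ i) dQ (hQ c i) vt.
    have [trr|tc] := hzero c r Xr hr; last by exists None; right; rewrite -tc rt.
    by rewrite rt in trr; exists (Some (SeqSub trr)).
  by exists phi, psi, (finfun d) => _; split=> // i; rewrite ffunE; exact: Ed.
have [tau Etau] := pigeonhole dat.
have [c0 [dc0 cs0]] := Etau _ (Xs0 s0).
rewrite hornerXsubC subr_eq0 in cs0.
have [aut0 nphi0 E0] := Edat c0 cs0.
pose u x := base (F c0 x).
pose A := [set i | tau i != None].
have cA : (span_dim.*2 * span_dim < #|A|)%N.
  have cP : (#|[set i : 'I_m | `[< pole (Q i) u >]]| <= span_dim)%N.
    apply: (pole_count (nzhc c0) aut0 Qinj) => i; rewrite inE => /asboolP po.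
    by split.
  have cV : (#|[set i : 'I_m | `[< has_val (Q i) u c0 >]]| <= span_dim)%N.
    apply: (val_count (nzhc c0) aut0 (t := c0) Qinj) => i; rewrite inE => /asboolP vc.
    by split.
  have AC : ~: A \subset [set i : 'I_m | `[< pole (Q i) u >]] :|:
                         [set i : 'I_m | `[< has_val (Q i) u c0 >]].
    apply/fintype.subsetP => i; rewrite !inE negbK => /eqP ti.
    by have := E0 i; rewrite dc0 ti => -[po|vc]; apply/orP; [left|right]; apply/asboolP.
  have cC : (#|~: A| <= span_dim.*2)%N.
    rewrite -addnn (leq_trans (subset_leq_card AC)) // (leq_trans (leq_card_setU _ _)) //.
    exact: leq_add.
  rewrite -(ltn_add2r #|~: A|) cardsC card_ord.
  by rewrite /m ltnS addnC leq_add2r.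
(* For c' with the same record, [rigidity] identifies u with s o phi' for the automorphism phi'
   attached to c'. A point over c' is removed for c', so there u is a zero of [rho] or equals c' =
   s. Thus R vanishes over infinitely many fibres. *)
pose R x := (u x - base x) * rho.[u x].
have regu := reg_base_aut aut0 : reg (h c0) u.
have regus : reg (h c0) (fun x => u x - base x).
  apply: reg_ext (regD regu (reg_meval (h c0) (- base_mp k n))) => x _.
  by rewrite mevalN meval_base_mp.
have [a [N Ea]] : reg (h c0) R := regM regus (reg_horner rho regu).
have a0 : forall x, onX x -> a.@[x] = 0.
  move=> x; apply: gen_base_zero x => r r0.
  have [c' [dc']] := Etau _ (mulf_neq0 (mulf_neq0 (mulf_neq0 r0 (Xs0 s0)) (Xs0 c0)) rho0).
  rewrite !hornerM !hornerXsubC !mulf_eq0 !negb_or !subr_eq0.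
  move=> /andP[/andP[/andP[rc' c's0] c'c0] /andP[/andP[dc nc] bc]].
  have [x Xx xc'] := fiber_ex n_gt0 c'.
  exists x; split; rewrite ?xc' //.
  have hx : Xh (h c0) x.
    split=> //; rewrite hE xc' !mulf_neq0 ?subr_eq0 //.
    by apply: contraNneq nc => wx; rewrite -xc' -Ew // wx mul0r.
  have [aut1 _ E1] := Edat c' c's0.
  have uu' : gen (fun y => u y = base (F c' y)).
    apply: (rigidity (nzhc c0) (nzhc c') aut0 aut1 Qinj XQ (A := A)) => // i.
    rewrite inE => ti; have := E0 i; have := E1 i; rewrite dc0 dc'.
    by case: (tau i) ti => // t _ v1 v0; exists (ssval t).
  have vx := val_gen uu' (reg_val hx regu).
  have hx' : (h c').@[x] = 0 by rewrite hE xc' subrr mulr0 mul0r.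
  have dx : (delta k n).[base x] != 0 by rewrite xc'.
  have [y [Xy hy yt]] := val_removed (nzhc c') aut1 Xx dx hx' vx.
  rewrite -Ea // /R.
  have [yr|yc] := hzero c' y Xy hy; last by rewrite -yt yc xc' subrr !mul0r.
  by rewrite -yt (eqP (_ : rho.[base y] == 0)) ?rrP // mulr0 mul0r.
have R0 x : Xh (h c0) x -> R x = 0.
  move=> Xx; have := Ea x Xx; rewrite a0; last by case: Xx.
  by move/eqP; rewrite mulf_eq0 expf_eq0 (negbTE Xx.2) andbF orbF => /eqP.
have [us|us] := rat_cases (reg_rat (nzhc c0) regus).
  apply: nphi0 => x Xx; apply/eqP; rewrite -subr_eq0; apply/eqP.
  exact: reg_eq0 regus us x Xx.
move: rho0; rewrite (base_aut_transcendental (nzhc c0) aut0 (c := rho)) ?eqxx //.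
apply: genS (genI (gen_Xh (nzhc c0)) us) => x _ [Xx /negbTE ux].
by have /eqP := R0 x Xx; rewrite mulf_eq0 ux => /eqP.
Qed.

End Germs.

(** * The affine curve *)

(** Cayley by right translation, because products of permutations compose from left to right;
    indices from #|G| on are fixed. *)
Lemma regular_embedding (G : finGroupType) n : (#|G| <= n)%N ->
  exists2 rho : G -> 'S_n, {morph rho : a b / (a * b)%g} & injective rho.
Proof.
move=> Gn.
pose r (a : G) (i : 'I_n) : 'I_n :=
  if insub (i : nat) is Some j then widen_ord Gn (enum_rank (enum_val (j : 'I_#|G|) * a)%g)
  else i.
have rM a b i : r (a * b)%g i = r b (r a i).
  rewrite /r; case: insubP => [j _ ji|ni]; last by rewrite insubN.
  case: insubP => [j' _ /=|]; last by rewrite /= ltn_ord.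
  by move=> /val_inj ->; rewrite enum_rankK mulgA.
have r1 i : r 1%g i = i.
  rewrite /r; case: insubP => [j _ ji|//]; rewrite mulg1 enum_valK.
  exact: val_inj.
have rinj a : injective (r a).
  by apply: (can_inj (g := r a^-1%g)) => i; rewrite -rM mulgV r1.
exists (fun a => perm (@rinj a)) => [a b|a b /permP].
  by apply/permP => i; rewrite permM !permE rM.
move=> /(_ (widen_ord Gn (enum_rank (1%g : G)))); rewrite !permE /r.
case: insubP => [j _ /=|]; last by rewrite /= ltn_ord.
move=> /val_inj ->; rewrite enum_rankK !mul1g => /(congr1 val) /= /val_inj.
exact: enum_rank_inj.
Qed.

(** * Functions on irreducible closed sets *)

Section IrreducibleClosed.
Variable k : closedFieldType.

Lemma irreducible_prod m (W : set 'rV[k]_m) (f g : {mpoly k[m]}) : irreducible_closed W ->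
  vanishes_on W (f * g) -> vanishes_on W f \/ vanishes_on W g.
Proof.
move=> [[S ES] _ irr] Wfg.
have cl (f' : {mpoly k[m]}) : zariski_closed (W `&` [set P | f'.@[P ord0] = 0])%classic.
  exists (S `|` [set f'])%classic; apply/seteqP; split=> P.
    by rewrite {1}ES => -[WP fP] f1 [/WP|->].
  by move=> H; split; [rewrite ES => f1 Sf1; apply: H; left | apply: H; right].
have [|E|E] := irr _ _ (cl f) (cl g).
- apply/seteqP; split=> P; last by case=> -[].
  move=> WP; have /eqP := Wfg P WP; rewrite mevalM mulf_eq0.
  by move=> /orP[] /eqP ?; [left | right].
- by left=> P; rewrite E => -[].
- by right=> P; rewrite E => -[].
Qed.

Lemma irreducible_const m (W : set 'rV[k]_m) (f : {mpoly k[m]}) (r : {poly k}) :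
  irreducible_closed W -> r != 0 -> (forall P, W P -> r.[f.@[P ord0]] = 0) ->
  exists c, forall P, W P -> f.@[P ord0] = c.
Proof.
move=> Wirr r0 Wr; have [s Es] := closed_field_poly_normal r.
have {}Wr : vanishes_on W (\prod_(c <- s) (f - c%:MP)).
  move=> P WP; have /eqP := Wr P WP; rewrite Es hornerZ mulf_eq0 lead_coef_eq0 (negbTE r0) /=.
  rewrite horner_prod rmorph_prod => /eqP E; rewrite -[RHS]E; apply: eq_bigr => c _ /=.
  by rewrite mevalB mevalC hornerXsubC.
elim: s {Es} Wr => [|c s IHs] Wr.
  have [_ [P WP] _] := Wirr; have /eqP := Wr P WP.
  by rewrite big_nil meval1 oner_eq0.
move: Wr; rewrite big_cons => /(irreducible_prod Wirr)[Wc|/IHs//].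
exists c => P /Wc; rewrite mevalB mevalC => /eqP; rewrite subr_eq0 => /eqP //.
Qed.

Lemma point_irreducible m (P0 : 'rV[k]_m) : irreducible_closed [set P0]%classic.
Proof.
split; last 1 first.
- move=> Y Z _ _ E; have : ([set P0] P0)%classic by [].
  rewrite {1}E => -[YP|ZP]; [left|right]; apply/seteqP; split=> P.
  + by move=> ->.
  + by move=> YP'; rewrite E; left.
  + by move=> ->.
  + by move=> ZP'; rewrite E; right.
- exists [set f | exists i, f = 'X_i - (P0 ord0 i)%:MP]%classic.
  apply/seteqP; split=> [P -> f [i ->]|P H]; first by rewrite mevalB mevalXU mevalC subrr.
  apply/rowP => i; have := H _ (ex_intro _ i erefl).
  by rewrite mevalB mevalXU mevalC => /eqP; rewrite subr_eq0 => /eqP.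
- by exists P0.
Qed.

End IrreducibleClosed.

Section OpenCurve.
Variables (k : closedFieldType) (n : nat).
Hypotheses (k0 : [pchar k] =i pred0) (p_pr : prime n.+1).
Variable h : {mpoly k[n.+1]}.
Hypotheses (nzh : nzX h) (dh : forall x, Xh h x -> (delta k n).[base x] != 0).

Local Notation pt := {ffun 'I_n.+1 -> k}.
Local Notation N := (n.+1 + 1)%N.
Implicit Types (x y q : pt) (P : 'rV[k]_N) (F : {mpoly k[N]}) (Q : {mpoly k[n.+1]}).

Let n_gt0 : (0 < n)%N. Proof. by move/prime_gt1: p_pr. Qed.

Definition xpart P : pt := [ffun i => P ord0 (lshift 1 i)].
Definition ypart P : k := P ord0 (rshift n.+1 ord0).

(* The open set h <> 0 becomes closed once 1 / h is added as a coordinate. *)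
Definition lift_pt x : 'rV[k]_N :=
  \row_j match fintype.split j with inl i => x i | inr _ => (h.@[x])^-1 end.

Definition open_curve : set 'rV[k]_N :=
  [set P | onX (xpart P) /\ ypart P * h.@[xpart P] = 1]%classic.

Lemma lift_ptl x i : lift_pt x ord0 (lshift 1 i) = x i.
Proof. by rewrite mxE (unsplitK (inl i)). Qed.

Lemma lift_ptr x i : lift_pt x ord0 (rshift n.+1 i) = (h.@[x])^-1.
Proof. by rewrite mxE (unsplitK (inr i)). Qed.

Lemma xpart_lift x : xpart (lift_pt x) = x.
Proof. by apply/ffunP => i; rewrite ffunE lift_ptl. Qed.

Lemma rV_eq P P' : xpart P = xpart P' -> ypart P = ypart P' -> P = P'.
Proof.
move=> /ffunP ex ey; apply/rowP => j; rewrite -[j]splitK.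
case: fintype.split => i /=; first by have := ex i; rewrite !ffunE.
by rewrite ord1.
Qed.

Lemma open_curve_lift x : Xh h x -> open_curve (lift_pt x).
Proof.
by move=> [Xx hx]; split; rewrite ?xpart_lift // /ypart lift_ptr mulVf.
Qed.

Lemma lift_xpart P : open_curve P -> lift_pt (xpart P) = P.
Proof.
move=> [XP yP]; apply: rV_eq; first exact: xpart_lift.
rewrite /ypart lift_ptr; have hP : h.@[xpart P] != 0.
  by apply: contra_eq_neq yP => ->; rewrite mulr0 eq_sym oner_neq0.
by apply: (mulIf hP); rewrite mulVf.
Qed.

Lemma Xh_xpart P : open_curve P -> Xh h (xpart P).
Proof.
move=> [XP yP]; split=> //.
by apply: contra_eq_neq yP => ->; rewrite mulr0 eq_sym oner_neq0.
Qed.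

Definition mlift Q : {mpoly k[N]} := Q \mPo [tuple 'X_(lshift 1 i) | i < n.+1].

Lemma meval_mlift Q P : (mlift Q).@[P ord0] = Q.@[xpart P].
Proof.
rewrite comp_mpoly_meval; apply: meval_eq => i.
by rewrite tnth_mktuple mevalXU ffunE.
Qed.

Lemma reg_coord j : reg h (fun x => lift_pt x ord0 j).
Proof.
rewrite -[j]splitK; case: fintype.split => i /=.
  by apply: reg_ext (reg_meval h 'X_i) => x _; rewrite mevalXU lift_ptl.
exists 1, 1%N => x [_ hx]; rewrite lift_ptr expr1 mulVf ?meval1 //.
Qed.

Lemma reg_lift F : reg h (fun x => F.@[lift_pt x ord0]).
Proof. exact: (@reg_comp _ _ h _ F (fun j x => lift_pt x ord0 j) reg_coord). Qed.

Lemma vanishes_lift F : gen (fun x => F.@[lift_pt x ord0] = 0) ->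
  vanishes_on open_curve F.
Proof.
move=> F0 P CP; rewrite -(lift_xpart CP).
exact: (reg_eq0 k0 p_pr (reg_lift F) F0 (Xh_xpart CP)).
Qed.

Lemma open_curve_domain F F' : vanishes_on open_curve (F * F') ->
  vanishes_on open_curve F \/ vanishes_on open_curve F'.
Proof.
move=> FF'; have [F0|nF] := rat_cases k0 p_pr (reg_rat k0 p_pr nzh (reg_lift F)).
  by left; exact: vanishes_lift.
right; apply: vanishes_lift.
apply: genS (genI k0 p_pr (gen_Xh nzh) nF) => x _ [/open_curve_lift/FF' + /negbTE Fx].
by rewrite mevalM => /eqP; rewrite mulf_eq0 Fx => /eqP.
Qed.

Lemma open_curve_closed : zariski_closed open_curve.
Proof.
exists (vanishes_on open_curve); apply/seteqP; split=> [P CP f|P CP]; first exact.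
split.
  move=> z; apply/eqP; rewrite -subr_eq0; apply/eqP.
  have E P' : (mlift (\prod_i (z%:MP - 'X_i) - ((trin n z)%:MP - base_mp k n))).@[P' ord0] =
      \prod_i (z - xpart P' i) - (trin n z - base (xpart P')).
    rewrite meval_mlift 2!mevalB mevalC meval_base_mp rmorph_prod; congr (_ - _).
    by apply: eq_bigr => i _; rewrite /= mevalB mevalC mevalXU.
  by rewrite -E; apply: CP => P' [XP' _]; rewrite E XP' subrr.
apply/eqP; rewrite -subr_eq0; apply/eqP.
have := CP ('X_(rshift n.+1 ord0) * mlift h - 1).
rewrite mevalB mevalM meval1 mevalXU meval_mlift; apply=> P' [_ yP'].
by rewrite mevalB mevalM meval1 mevalXU meval_mlift yP' subrr.
Qed.

Lemma open_curve_infinite P0 : exists2 P, open_curve P & P <> P0.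
Proof.
have [x Xx [Hx nx]] := gen_ex (genI k0 p_pr (gen_Xh nzh) (gen_base_neq p_pr (base (xpart P0)))).
exists (lift_pt x); first exact: open_curve_lift.
by move=> e; move: nx; rewrite -e xpart_lift eqxx.
Qed.

Lemma open_curve_irreducible : irreducible_closed open_curve.
Proof.
split; first exact: open_curve_closed.
  by have [P CP _] := open_curve_infinite 0; exists P.
move=> Y Z [S ->] [T ->] CST; apply: contrapT => /not_orP[nS nT].
have [f [fS [P CP fP]]] : exists f, S f /\ exists2 P, open_curve P & f.@[P ord0] <> 0.
  apply: contrapT => nf; apply: nS; apply/seteqP; split=> P; last by rewrite CST; left.
  move=> CP f fS; apply: contrapT => fP; apply: nf.
  by exists f; split=> //; exists P.
have [g [gT [P' CP' gP']]] : exists g, T g /\ exists2 P, open_curve P & g.@[P ord0] <> 0.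
  apply: contrapT => nf; apply: nT; apply/seteqP; split=> P1; last by rewrite CST; right.
  move=> CP1 g gT; apply: contrapT => gP; apply: nf.
  by exists g; split=> //; exists P1.
have [|/(_ P CP)//|/(_ P' CP')//] := @open_curve_domain f g.
by move=> P1; rewrite CST mevalM => -[/(_ f fS)->|/(_ g gT)->]; rewrite ?mul0r ?mulr0.
Qed.

(** The norm of the numerator of f is a nonzero polynomial in s vanishing on W, so s takes finitely
    many values there and is constant; then each coordinate, a root of a fixed trinomial, is
    constant too. *)
Lemma irreducible_proper W f P0 : irreducible_closed W -> (W `<=` open_curve)%classic ->
  vanishes_on W f -> open_curve P0 -> f.@[P0 ord0] != 0 ->
  forall P P', W P -> W P' -> P = P'.
Proof.
move=> Wirr WC Wf CP0 fP0.
have [a [M Ea]] := reg_lift f.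
have nza : nzX a.
  exists (xpart P0); first by case: CP0.
  have Xx := Xh_xpart CP0; rewrite -Ea // lift_xpart // mulf_neq0 // expf_neq0 //.
  by case: Xx.
have [r r0 [a' Er]] := nzX_norm k0 p_pr nza.
have [c Wc] : exists c, forall P, W P -> (mlift (base_mp k n)).@[P ord0] = c.
  apply: (irreducible_const Wirr r0) => P WP; have CP := WC _ WP.
  rewrite meval_mlift meval_base_mp -Er; last by case: CP.
  by rewrite -Ea ?lift_xpart ?Wf ?mul0r //; exact: Xh_xpart.
have f0 : trin_poly k n - c%:P != 0.
  by rewrite -size_poly_gt0 /trin_poly -addrA size_polyDl ?size_polyXn // -opprD size_polyN
    size_polyDl size_polyX // ltnS (leq_trans (size_polyC_leq1 _)).
have Wi i : exists d, forall P, W P -> (mlift 'X_i).@[P ord0] = d.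
  apply: (irreducible_const Wirr f0) => P WP; have CP := WC _ WP.
  rewrite hornerD hornerN hornerC horner_trin_poly meval_mlift mevalXU onX_trin; last by case: CP.
  by rewrite -(Wc P WP) meval_mlift meval_base_mp subrr.
move=> P P' WP WP'; rewrite -(lift_xpart (WC _ WP)) -(lift_xpart (WC _ WP')).
congr lift_pt; apply/ffunP => i; have [d Ed] := Wi i.
by have := Ed P' WP'; rewrite -(Ed P WP) !meval_mlift !mevalXU.
Qed.

Lemma open_curve_dim : has_dimension open_curve 1.
Proof.
split.
  have [P0 CP0 _] := open_curve_infinite 0.
  exists (fun i => if i is 0%N then [set P0]%classic else open_curve); split.
    case=> [_|[|//] _]; split=> //; [exact: point_irreducible | by move=> P -> |].
    exact: open_curve_irreducible.
  case=> // _; split; first by move=> P ->.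
  have [P CP nP] := open_curve_infinite P0.
  by move=> /(_ P CP).
(* In a longer chain the middle set misses a point of the curve, hence is a single point, which
   leaves no room below it. *)
move=> [Z [Zirr Zlt]].
have [irr1 ZC1] := Zirr 1%N isT; have [irr2 ZC2] := Zirr 2%N isT.
have [irr0 _] := Zirr 0%N isT.
have [Z12 nZ21] := Zlt 1%N isT; have [Z01 nZ10] := Zlt 0%N isT.
have [P ZP nP] : exists2 P, Z 2%N P & ~ Z 1%N P.
  by apply: contrapT => nP; apply: nZ21 => P ZP; apply: contrapT => n1; apply: nP; exists P.
have [[S ES] _ _] := irr1.
have [f Sf fP] : exists2 f, S f & f.@[P ord0] != 0.
  apply: contrapT => nf; apply: nP; rewrite ES => f Sf; apply/eqP.
  by apply: contraT => fP; case: nf; exists f.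
have Zf : vanishes_on (Z 1%N) f by move=> P1; rewrite ES => /(_ f Sf).
have single := irreducible_proper irr1 ZC1 Zf (ZC2 _ ZP) fP.
have [_ [P0 ZP0] _] := irr0.
by apply: nZ10 => P1 ZP1; rewrite (single _ _ ZP1 (Z01 _ ZP0)).
Qed.

Definition differential F P (u : 'rV[k]_N) : k := \sum_j F^`M(j).@[P ord0] * u ord0 j.

Lemma differentialM F F' P u : differential (F * F') P u =
  differential F P u * F'.@[P ord0] + F.@[P ord0] * differential F' P u.
Proof.
rewrite mulr_suml mulr_sumr -big_split; apply: eq_bigr => j _ /=.
by rewrite mderivM mevalD !mevalM; ring.
Qed.

Lemma differentialB F F' P u :
  differential (F - F') P u = differential F P u - differential F' P u.
Proof.
rewrite -sumrB; apply: eq_bigr => j _.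
by rewrite mderivB mevalB mulrBl.
Qed.

Lemma differentialXU i P u : differential 'X_i P u = u ord0 i.
Proof.
rewrite /differential (bigD1 i) //= big1 => [|j ji].
  rewrite addr0 mderivX mnm1E eqxx scale1r (_ : (U_(i) - U_(i))%MM = 0%MM).
    by rewrite mpolyX0 meval1 mul1r.
  by apply/mnmP => j; rewrite mnmBE mnm0E subnn.
by rewrite mderivX mnm1E eq_sym (negbTE ji) scale0r meval0 mul0r.
Qed.

Lemma differential1 P u : differential 1 P u = 0.
Proof.
by rewrite /differential big1 // => j _; rewrite -[1]/(1%:MP) mderivC meval0 mul0r.
Qed.

Lemma differentialX i m P u : differential ('X_i ^+ m.+1) P u =
  m.+1%:R * P ord0 i ^+ m * u ord0 i.
Proof.
elim: m => [|m IHm]; first by rewrite expr1 differentialXU expr0 mul1r mul1r.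
rewrite exprS differentialM IHm differentialXU rmorphXn /= mevalXU.
by rewrite [in RHS]mulrS exprS; ring.
Qed.

Lemma mderiv_mlift Q : (mlift Q)^`M(rshift n.+1 ord0) = 0.
Proof.
have zM (F F' : {mpoly k[N]}) : F^`M(rshift n.+1 ord0) = 0 ->
    F'^`M(rshift n.+1 ord0) = 0 -> (F * F')^`M(rshift n.+1 ord0) = 0.
  by move=> F0 F'0; rewrite mderivM F0 F'0 mul0r mulr0 addr0.
have z1 : (1 : {mpoly k[N]})^`M(rshift n.+1 ord0) = 0 by rewrite -[1]/(1%:MP) mderivC.
rewrite /mlift comp_mpolyEX raddf_sum big1 // => m _; rewrite /= mderivZ.
rewrite comp_mpolyX; set G := (G in G^`M(_)); suff -> : G^`M(rshift n.+1 ord0) = 0.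
  by rewrite scaler0.
apply: (big_ind (fun F => F^`M(rshift n.+1 ord0) = 0)) => [||i _]; [exact: z1 | exact: zM |].
elim: (m i) => [|e IHe]; first by rewrite expr0.
rewrite exprS; apply: zM => //; rewrite tnth_mktuple mderivX mnm1E.
by rewrite eq_lrshift scale0r.
Qed.

(** The tangent line is spanned by the velocity v of the lifted point with respect to s. Conversely,
    the equations trin x_i = trin x_0 and y h = 1 determine a tangent vector from its first
    coordinate. *)
Lemma open_curve_smooth : smooth open_curve.
Proof.
exists 1%N; split; first exact: open_curve_dim.
move=> P CP; set q := xpart P; have [Xq hq] := Xh_xpart CP; have dq := dh (conj Xq hq).
have EP : lift_pt q = P by exact: lift_xpart.
have [vy Dy] := der_inv k0 p_pr Xq (der_meval k0 p_pr Xq dq h) hq.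
pose v : 'rV[k]_N := \row_j match fintype.split j with
  | inl i => (dtrin n (q i))^-1 | inr _ => vy end.
have vl i : v ord0 (lshift 1 i) = (dtrin n (q i))^-1 by rewrite mxE (unsplitK (inl i)).
have vr i : v ord0 (rshift n.+1 i) = vy by rewrite mxE (unsplitK (inr i)).
have Dv j : der q (fun x => lift_pt x ord0 j) (P ord0 j) (v ord0 j).
  rewrite -[j]splitK -EP; case: fintype.split => i /=.
    rewrite lift_ptl vl; apply: der_gen (der_coord k0 p_pr Xq dq i) => //.
    by apply: (genT p_pr) => x _; rewrite lift_ptl.
  rewrite lift_ptr vr; apply: der_gen Dy => //.
  by apply: (genT p_pr) => x _; rewrite lift_ptr.
have tanv c f : vanishes_on open_curve f -> differential f P (c *: v) = 0.
  move=> Cf; have -> : differential f P (c *: v) = c * differential f P v.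
    by rewrite mulr_sumr; apply: eq_bigr => j _; rewrite mxE mulrCA.
  rewrite (_ : differential f P v = 0) ?mulr0 //.
  have := der_comp k0 p_pr f Dv; rewrite (Cf P CP) => Df.
  apply: (val_uniq k0 p_pr Xq Df); apply: (val_gen k0 p_pr) (val_const k0 p_pr q 0).
  apply: genS (gen_Xh nzh) => x _ /open_curve_lift/Cf /= ->.
  by rewrite subrr mul0r.
exists <[v]>%VS; split; last first.
  rewrite dim_vline (_ : v != 0) //; apply/eqP => /rowP/(_ (lshift 1 ord0)).
  by rewrite vl mxE => /eqP; rewrite invr_eq0 (negbTE (delta_dtrin k0 n_gt0 _ Xq dq)).
apply/seteqP; split=> u; first by move=> /vlineP[c ->] f Cf; exact: tanv.
(* The scalar is the derivative of s along u, since s has derivative 1 along v. *)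
move=> tu; apply/vlineP; exists (dtrin n (q ord0) * u ord0 (lshift 1 ord0)).
set c := _ * _; pose u' := u - c *: v.
have tu' f : vanishes_on open_curve f -> differential f P u' = 0.
  move=> Cf; have := tanv c f Cf; have := tu f Cf; rewrite -/(differential f P u) => d1 d2.
  rewrite -[RHS](subrr 0) -{1}d1 -d2 -sumrB; apply: eq_bigr => j _.
  by rewrite !mxE mulrBr.
have ul i : u' ord0 (lshift 1 i) = 0.
  rewrite /u' 3!mxE vl.
  have := tu (('X_(lshift 1 i) ^+ n.+1 - 'X_(lshift 1 i)) -
              ('X_(lshift 1 ord0) ^+ n.+1 - 'X_(lshift 1 ord0))).
  rewrite -/(differential _ P u) 3!differentialB !differentialX !differentialXU => E.
  have {E} : dtrin n (q i) * u ord0 (lshift 1 i) = c.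
    rewrite /c /dtrin /q !ffunE; apply/eqP; rewrite -subr_eq0 -[X in _ == X]E; last first.
      move=> P' [XP' _]; rewrite !mevalB !rmorphXn /= !mevalXU.
      by have := onX_trin i XP'; rewrite !ffunE /base /trin ffunE => ->; rewrite subrr.
    by apply/eqP; ring.
  by move=> <-; rewrite mulrAC mulfV ?mul1r ?subrr // (delta_dtrin k0 n_gt0 _ Xq dq).
have ur : u' ord0 (rshift n.+1 ord0) = 0.
  have := tu' ('X_(rshift n.+1 ord0) * mlift h - 1).
  rewrite differentialB differentialM differentialXU differential1 meval_mlift subr0.
  rewrite [X in _ + _ * X](_ : _ = 0); last first.
    apply: big1 => j _; rewrite -[j]splitK; case: fintype.split => i /=.
      by rewrite ul mulr0.
    by have -> : i = ord0; [exact: ord1 | rewrite mderiv_mlift meval0 mul0r].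
  rewrite mulr0 addr0 => E; apply: (mulIf hq); rewrite mul0r; apply: E => P' [_ yP'].
  by rewrite mevalB mevalM meval1 mevalXU meval_mlift yP' subrr.
apply/eqP; rewrite -subr_eq0 -/u'; apply/eqP/rowP => j; rewrite [RHS]mxE -[j]splitK.
case: fintype.split => i /=; first exact: ul.
by have -> : i = ord0; [exact: ord1 | exact: ur].
Qed.

Lemma Xh_val (c : open_curve) : Xh h (xpart (\val c)).
Proof. exact: Xh_xpart (set_mem (valP c)). Qed.

Definition curve_pt x (Hx : Xh h x) : open_curve :=
  exist _ (lift_pt x) (mem_set (open_curve_lift Hx)).

Lemma curve_ptK (c : open_curve) (Hc : Xh h (xpart (\val c))) : curve_pt Hc = c.
Proof. by apply: val_inj; exact: lift_xpart (set_mem (valP c)). Qed.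

(** Off the open set the value is an arbitrary default; [isaut] constrains only points of [Xh h]. *)
Definition on_pt (f : open_curve -> open_curve) x : pt :=
  if pselect (Xh h x) is left Hx then xpart (\val (f (curve_pt Hx))) else x.

Lemma on_ptE f (c : open_curve) : on_pt f (xpart (\val c)) = xpart (\val (f c)).
Proof.
by rewrite /on_pt; case: pselect => [Hc|/(_ (Xh_val c))//]; rewrite curve_ptK.
Qed.

Lemma on_pt_lift f x (Hx : Xh h x) : on_pt f x = xpart (\val (f (curve_pt Hx))).
Proof. by have := on_ptE f (curve_pt Hx); rewrite /= xpart_lift. Qed.

Lemma reg_on_pt f i : regular_map f -> reg h (fun x => on_pt f x i).
Proof.
move=> [F EF]; apply: reg_ext (reg_lift (F (lshift 1 i))) => x Hx.
by rewrite (on_pt_lift _ Hx) ffunE EF mxE.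
Qed.

Lemma isaut_on_pt f g : regular_map f -> regular_map g -> cancel f g -> cancel g f ->
  isaut h (on_pt f) (on_pt g).
Proof.
move=> fr gr fK gK; split; last by split=> i; exact: reg_on_pt.
split=> x Hx; rewrite !(on_pt_lift _ Hx) ?on_ptE ?fK ?gK /= ?xpart_lift //; exact: Xh_val.
Qed.

Variable H : {group 'S_n.+1}.
Hypothesis invh : forall s, s \in H -> forall x, onX x -> h.@[act s x] = h.@[x].

Lemma Xh_act s x : s \in H -> Xh h x -> Xh h (act s x).
Proof. by move=> sH [Xx hx]; split; [exact: onX_act | rewrite invh]. Qed.

Definition perm_fun s (sH : s \in H) (c : open_curve) : open_curve :=
  curve_pt (Xh_act sH (Xh_val c)).

Lemma xpart_perm_fun s (sH : s \in H) c :
  xpart (\val (perm_fun sH c)) = act s (xpart (\val c)).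
Proof. exact: xpart_lift. Qed.

Lemma curve_eq (c d : open_curve) : xpart (\val c) = xpart (\val d) -> c = d.
Proof.
move=> e; apply: val_inj; rewrite -(lift_xpart (set_mem (valP c))) e.
exact: lift_xpart (set_mem (valP d)).
Qed.

Lemma regular_perm_fun s (sH : s \in H) : regular_map (perm_fun sH).
Proof.
exists (fun j => match fintype.split j with
  | inl i => 'X_(lshift 1 (s i)) | inr i => 'X_(rshift n.+1 i) end) => c.
apply/rowP => j; rewrite !mxE; case: fintype.split => i; rewrite mevalXU.
  by rewrite !ffunE.
rewrite invh //; last by case: (Xh_val c).
by rewrite -[in RHS](lift_xpart (set_mem (valP c))) lift_ptr.
Qed.

Lemma perm_fun_automorphism s (sH : s \in H) : is_automorphism (perm_fun sH).
Proof.
split; first exact: regular_perm_fun.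
have sH' : (s^-1)%g \in H by rewrite groupV.
exists (perm_fun sH'); split; first exact: regular_perm_fun.
  by move=> c; apply: curve_eq; rewrite !xpart_perm_fun actK.
by move=> c; apply: curve_eq; rewrite !xpart_perm_fun actKV.
Qed.

Lemma open_curve_aut (G : finGroupType) (rho : G -> 'S_n.+1) :
  {morph rho : a b / (a * b)%g} -> injective rho -> (forall a, rho a \in H) ->
  (forall s, s \in H -> exists a, s = rho a) ->
  (forall phi psi, isaut h phi psi ->
    exists2 s, s \in H & forall x, Xh h x -> phi x = act s x) ->
  group_isomorphic (var_aut open_curve) G.
Proof.
move=> rhoM rhoI rhoH Hrho rigid.
pose g a : var_aut open_curve :=
  VarAut (introT (asboolP _) (perm_fun_automorphism (rhoH a))).
have gM a b : g (a * b)%g = (g a * g b)%g.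
  apply: var_aut_ext => c /=; apply: curve_eq.
  by rewrite !xpart_perm_fun rhoM actM.
have ginj : injective g.
  move=> a b gab; apply: rhoI; apply/permP => i.
  (* A kept point is unramified, so its coordinates are distinct and it determines the permutation
     applied to it. *)
  have [x _ Hx] := gen_ex (gen_Xh nzh).
  have := congr1 (fun u : var_aut open_curve => xpart (\val (u (curve_pt Hx)))) gab.
  rewrite /= !xpart_lift => /ffunP/(_ i); rewrite !ffunE.
  exact: (delta_inj k0 n_gt0 Hx.1 (dh Hx)).
have gsurj f : exists a, g a = f.
  have /asboolP[rf [f' [rf' fK f'K]]] := var_autP f.
  have [s /Hrho[a ->] Es] := rigid _ _ (isaut_on_pt rf rf' fK f'K).
  exists a; apply: var_aut_ext => c; apply: curve_eq.
  by rewrite /= xpart_lift -(Es _ (Xh_val c)) on_ptE.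
have [g' Eg'] := choice gsurj.
have g'K : cancel g g' by move=> a; apply: ginj.
exists g'; split; last by exists g.
by move=> f1 f2; apply: ginj; rewrite gM !Eg'.
Qed.

End OpenCurve.

Theorem theorem1p2 (k : closedFieldType) (k_char0 : [pchar k]%R =i pred0)
    (G : finGroupType) :
  exists (n : nat) (C : set 'rV[k]_n),
    affine_curve C /\ smooth C /\ group_isomorphic (var_aut C) G.
Proof.
have [[//|n] Gn p_pr] := prime_above #|G|.
have [rho rhoM rhoI] := regular_embedding (ltnW Gn).
have gH : group_set [set rho a | a : G]%SET.
  apply/group_setP; split.
    apply/imsetP; exists 1%g => //; apply: (mulgI (rho 1%g)).
    by rewrite -rhoM !mulg1.
  by move=> _ _ /imsetP[a _ ->] /imsetP[b _ ->]; rewrite -rhoM imset_f.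
have [h [nzh dh Hh rigid]] := rigid_open_curve k_char0 p_pr (Group gH).
exists (n.+1 + 1)%N, (open_curve h); split; [split | split].
- exact: open_curve_irreducible.
- exact: open_curve_dim.
- exact: open_curve_smooth.
- apply: (open_curve_aut k_char0 p_pr nzh dh (H := Group gH)) rigid => //.
  + by move=> a; apply: imset_f.
  + by move=> s /imsetP[a _ ->]; exists a.
Qed.
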